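(* Consider the 2D first-order Lax–Friedrichs scheme $$\bar{\mathbf U}_{ij}^{n+1}=\bar{\mathbf U}_{ij}^n-\frac{\Delta t_n}{\Delta x}\Big(\hat{\mathbf F}_1(\bar{\mathbf U}_{ij}^n,\bar{\mathbf U}_{i+1,j}^n)-\hat{\mathbf F}_1(\bar{\mathbf U}_{i-1,j}^n,\bar{\mathbf U}_{ij}^n)\Big)-\frac{\Delta t_n}{\Delta y}\Big(\hat{\mathbf F}_2(\bar{\mathbf U}_{ij}^n,\bar{\mathbf U}_{i,j+1}^n)-\hat{\mathbf F}_2(\bar{\mathbf U}_{i,j-1}^n,\bar{\mathbf U}_{ij}^n)\Big)$$ and the discrete divergence-free (DDF) condition $$\mathrm{div}_{ij}\bar{\mathbf B}^n:=\frac{(\bar B_1)_{i+1,j}^n-(\bar B_1)_{i-1,j}^n}{2\Delta x}+\frac{(\bar B_2)_{i,j+1}^n-(\bar B_2)_{i,j-1}^n}{2\Delta y}=0.$$ Assume that the discrete initial data $\{\bar{\mathbf U}_{ij}^0\}$ are admissible (belong to $\mathcal G$) and satisfy the DDF condition for all $i,j$. This can be met by, e.g., the following second-order approximation: $$\Big(\bar\rho_{ij}^0,\bar{\mathbf m}_{ij}^0,(\bar B_3)_{ij}^0,\overline{(\rho e)}_{ij}^0\Big)=\frac1{\Delta x\Delta y}\iint_{I_{ij}}(\rho,\mathbf m,B_3,\rho e)(x,y,0)\,dx\,dy,$$ $$(\bar B_1)_{ij}^0=\frac1{2\Delta y}\int_{y_{j-1}}^{y_{j+1}}B_1(x_i,y,0)\,dy,\qquad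 (\bar B_2)_{ij}^0=\frac1{2\Delta x}\int_{x_{i-1}}^{x_{i+1}}B_2(x,y_j,0)\,dx,$$ $$\bar E_{ij}^0=\overline{(\rho e)}_{ij}^0+\frac12\Big(\frac{|\bar{\mathbf m}_{ij}^0|^2}{\bar\rho_{ij}^0}+|\bar{\mathbf B}_{ij}^0|^2\Big).$$ If at each time level the parameters satisfy $$\alpha_{1,n}^{LF}>\max_{i,j}\alpha_1(\bar{\mathbf U}_{i+1,j}^n,\bar{\mathbf U}_{i-1,j}^n),\qquad \alpha_{2,n}^{LF}>\max_{i,j}\alpha_2(\bar{\mathbf U}_{i,j+1}^n,\bar{\mathbf U}_{i,j-1}^n),$$ then under the CFL condition $$0<\frac{\alpha_{1,n}^{LF}\Delta t_n}{\Delta x}+\frac{\alpha_{2,n}^{LF}\Delta t_n}{\Delta y}\le1,$$ the LF scheme always preserves both $\bar{\mathbf U}_{ij}^{n+1}\in\mathcal G$ and the DDF condition for all $i$, $j$ and $n\in\mathbb N$.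
   Context: A state is $\mathbf U=(\rho,\mathbf m,\mathbf B,E)^\top\in\mathbb R^8$ with $\rho,E\in\mathbb R$, $\mathbf m,\mathbf B\in\mathbb R^3$. For $\rho>0$ put $\mathbf v=\mathbf m/\rho$, $\mathcal E(\mathbf U)=E-\frac12\big(\frac{|\mathbf m|^2}{\rho}+|\mathbf B|^2\big)=\rho e$, $p=p(\rho,e)$, $p_{tot}=p+\frac{|\mathbf B|^2}{2}$. The equation of state $p(\rho,e)$ is any function such that, whenever $\rho>0$, one has $e>0\Leftrightarrow p(\rho,e)>0$. Admissible states: $\mathcal G=\{\mathbf U:\rho>0,\ \mathcal E(\mathbf U)>0\}$. Flux: $$\mathbf F_\ell(\mathbf U)=\big(\rho v_\ell,\ \rho v_\ell\mathbf v-B_\ell\mathbf B+p_{tot}\mathbf e_\ell,\ v_\ell\mathbf B-B_\ell\mathbf v,\ v_\ell(E+p_{tot})-B_\ell(\mathbf v\cdot\mathbf B)\big)^\top,$$ with $\mathbf e_\ell$ the $\ell$-th standard unit vector of $\mathbb R^3$. LF flux: $\hat{\mathbf F}_\ell(\mathbf U^-,\mathbf U^+)=\frac12\big(\mathbf F_\ell(\mathbf U^-)+\mathbf F_\ell(\mathbf U^+)-\alpha_{\ell,n}^{LF}(\mathbf U^+-\mathbf U^-)\big)$. For $\mathbf U,\tilde{\mathbf U}\in\mathcal G$, $\alpha_\ell(\mathbf U,\tilde{\mathbf U})=\min_{\sigma\in\mathbb R}\alpha_\ell(\mathbf U,\tilde{\mathbf U};\sigma)$ with $$\alpha_\ell(\mathbf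 U,\tilde{\mathbf U};\sigma)=\max\big\{|v_\ell|+\mathscr C_\ell,\ |\tilde v_\ell|+\tilde{\mathscr C}_\ell,\ |\sigma v_\ell+(1-\sigma)\tilde v_\ell|+\max\{\mathscr C_\ell,\tilde{\mathscr C}_\ell\}\big\}+\frac{|\tilde{\mathbf B}-\mathbf B|}{\sqrt2}\sqrt{\frac{\sigma^2}{\rho}+\frac{(1-\sigma)^2}{\tilde\rho}},$$ $$\mathscr C_\ell=\frac1{\sqrt2}\Big[\mathscr C_s^2+\frac{|\mathbf B|^2}{\rho}+\sqrt{\Big(\mathscr C_s^2+\frac{|\mathbf B|^2}{\rho}\Big)^2-4\frac{\mathscr C_s^2B_\ell^2}{\rho}}\Big]^{1/2},\qquad \mathscr C_s=\frac{p}{\rho\sqrt{2e}},$$ and $\tilde{\mathscr C}_\ell$ the same quantity for $\tilde{\mathbf U}$. The mesh is uniform rectangular with cells $I_{ij}=(x_{i-\frac12},x_{i+\frac12})\times(y_{j-\frac12},y_{j+\frac12})$ centered at $(x_i,y_j)$, spacings $\Delta x,\Delta y>0$ and indices $(i,j)\in\mathbb Z^2$ (maxima over indices understood as suprema); $(\bar B_k)_{ij}^n$ is the $k$-th magnetic component of $\bar{\mathbf U}_{ij}^n$. In the example of initial data, $(\rho,\mathbf m,\mathbf B,\rho e)(x,y,0)$ are the (sufficiently regular) exact initial data, with $\rho>0$, $\rho e>0$ and $\partial_xB_1+\partial_yB_2=0$. *)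

(* Defs.v *)
From Stdlib Require Import Reals ZArith Lra.
From Coquelicot Require Import Coquelicot.
Open Scope R_scope.

Definition vec : Type := (R * R * R)%type.

Inductive axis : Set := ax1 | ax2 | ax3.

Definition comp (l : axis) (u : vec) : R :=
  match l with
  | ax1 => fst (fst u)
  | ax2 => snd (fst u)
  | ax3 => snd u
  end.

Definition vec_of (f : axis -> R) : vec := (f ax1, f ax2, f ax3).

Definition unit_vec (l : axis) : vec :=
  match l with
  | ax1 => (1, 0, 0)
  | ax2 => (0, 1, 0)
  | ax3 => (0, 0, 1)
  end.

Definition dot (u v : vec) : R :=
  comp ax1 u * comp ax1 v + comp ax2 u * comp ax2 v + comp ax3 u * comp ax3 v.

Definition vnorm (u : vec) : R := sqrt (dot u u).

(* [(rho, m, B, E)].  Being a product of copies of [R], this type carries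
   Coquelicot's componentwise [plus], [minus], [scal] and Euclidean [norm]. *)
Definition state : Type := (R * vec * vec * R)%type.

Definition rho (U : state) : R := fst (fst (fst U)).
Definition mom (U : state) : vec := snd (fst (fst U)).
Definition mag (U : state) : vec := snd (fst U).
Definition ener (U : state) : R := snd U.

Definition vel (U : state) : vec := scal (/ rho U) (mom U).

(* [calE U = rho * e]. *)
Definition calE (U : state) : R :=
  ener U - / 2 * (dot (mom U) (mom U) / rho U + dot (mag U) (mag U)).

Definition sie (U : state) : R := calE U / rho U.

Definition admissible (U : state) : Prop := 0 < rho U /\ 0 < calE U.

(* [p r e] is the pressure at density [r] and specific internal energy [e]. *)
Definition eos (p : R -> R -> R) : Prop :=
  forall r e, 0 < r -> (0 < e <-> 0 < p r e).

Definition pressure (p : R -> R -> R) (U : state) : R := p (rho U) (sie U).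

Definition ptot (p : R -> R -> R) (U : state) : R :=
  pressure p U + dot (mag U) (mag U) / 2.

Definition flux (p : R -> R -> R) (l : axis) (U : state) : state :=
  let v := vel U in
  let B := mag U in
  (rho U * comp l v,
   plus (minus (scal (rho U * comp l v) v) (scal (comp l B) B))
        (scal (ptot p U) (unit_vec l)),
   minus (scal (comp l v) B) (scal (comp l B) v),
   comp l v * (ener U + ptot p U) - comp l B * dot v B).

Definition sound (p : R -> R -> R) (U : state) : R :=
  pressure p U / (rho U * sqrt (2 * sie U)).

Definition speed (p : R -> R -> R) (l : axis) (U : state) : R :=
  let s := (sound p U) ^ 2 + dot (mag U) (mag U) / rho U in
  / sqrt 2 *
  sqrt (s + sqrt (s ^ 2 - 4 * ((sound p U) ^ 2 * (comp l (mag U)) ^ 2 / rho U))).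

Definition alpha_sigma (p : R -> R -> R) (l : axis) (U U' : state) (s : R) : R :=
  Rmax (Rabs (comp l (vel U)) + speed p l U)
    (Rmax (Rabs (comp l (vel U')) + speed p l U')
       (Rabs (s * comp l (vel U) + (1 - s) * comp l (vel U'))
        + Rmax (speed p l U) (speed p l U')))
  + vnorm (minus (mag U') (mag U)) / sqrt 2
    * sqrt (s ^ 2 / rho U + (1 - s) ^ 2 / rho U').

(* The infimum over [s]; it is attained for admissible states, see
   [alpha_is_min] below. *)
Definition alpha (p : R -> R -> R) (l : axis) (U U' : state) : R :=
  real (Glb_Rbar (fun a => exists s, a = alpha_sigma p l U U' s)).

Lemma coercive_min (f : R -> R) (c k : R) :
  (forall s, continuous f s) -> 0 < c ->
  (forall s, c * Rabs s - k <= f s) ->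
  exists s, forall t, f s <= f t.
Proof.
intros Cf Hc Hk.
set (M := Rabs ((f 0 + k) / c)).
assert (HM : 0 <= M) by apply Rabs_pos.
destruct (continuity_ab_min f (- M) M) as [s [Hs _]].
- lra.
- intros x _; apply continuity_pt_filterlim; exact (Cf x).
- exists s; intros t.
  destruct (Rle_lt_dec (Rabs t) M) as [Ht | Ht].
  + apply Hs. apply Rabs_le_between; exact Ht.
  + apply Rle_trans with (f 0).
    * apply Hs; lra.
    * apply Rle_trans with (2 := Hk t).
      assert (H1 : (f 0 + k) / c <= M) by apply Rle_abs.
      assert (H2 : (f 0 + k) / c * c = f 0 + k) by (field; lra).
      nra.
Qed.

Lemma continuous_affine (v w s : R) : continuous (fun t : R => t * v + (1 - t) * w) s.
Proof.
apply (@ex_derive_continuous R_AbsRing R_NormedModule); auto_derive; exact I.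
Qed.

Lemma continuous_Rmax_comp (f g : R -> R) (s : R) :
  continuous f s -> continuous g s -> continuous (fun t : R => Rmax (f t) (g t)) s.
Proof.
intros Cf Cg.
apply continuous_ext with (fun t => / 2 * (f t + g t + Rabs (f t - g t))).
- intros t; unfold Rmax, Rabs.
  destruct (Rle_dec (f t) (g t)); destruct (Rcase_abs (f t - g t)); simpl; lra.
- apply (continuous_scal_r (/ 2) (fun t => f t + g t + Rabs (f t - g t))).
  apply (continuous_plus (fun t => f t + g t) (fun t => Rabs (f t - g t))).
  + apply (continuous_plus f g); assumption.
  + apply (continuous_Rabs_comp (fun t => f t - g t)).
    apply (continuous_minus f g); assumption.
Qed.

Lemma alpha_profile_min (a b m v w d r r' : R) :
  0 <= a -> 0 <= m -> 0 <= d -> 0 < r -> 0 < r' ->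
  exists s, forall t,
    (fun s => Rmax a (Rmax b (Rabs (s * v + (1 - s) * w) + m))
              + d * sqrt (s ^ 2 / r + (1 - s) ^ 2 / r')) s <=
    (fun s => Rmax a (Rmax b (Rabs (s * v + (1 - s) * w) + m))
              + d * sqrt (s ^ 2 / r + (1 - s) ^ 2 / r')) t.
Proof.
intros Ha Hm Hd Hr Hr'.
assert (Hq : forall s, 0 <= s ^ 2 / r /\ 0 <= (1 - s) ^ 2 / r').
{ intros s; split; apply Rdiv_le_0_compat; trivial; apply pow2_ge_0. }
assert (C : forall s, continuous (fun s => Rmax a (Rmax b (Rabs (s * v + (1 - s) * w) + m))
              + d * sqrt (s ^ 2 / r + (1 - s) ^ 2 / r')) s).
{ intros s.
  apply (continuous_plus (fun s => Rmax a (Rmax b (Rabs (s * v + (1 - s) * w) + m)))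
           (fun s => d * sqrt (s ^ 2 / r + (1 - s) ^ 2 / r'))).
  - apply continuous_Rmax_comp; [apply continuous_const|].
    apply continuous_Rmax_comp; [apply continuous_const|].
    apply (continuous_plus (fun s => Rabs (s * v + (1 - s) * w)) (fun _ => m));
      [|apply continuous_const].
    apply (continuous_Rabs_comp (fun s => s * v + (1 - s) * w)).
    apply continuous_affine.
  - apply (continuous_scal_r d (fun s => sqrt (s ^ 2 / r + (1 - s) ^ 2 / r'))).
    apply (continuous_sqrt_comp (fun s => s ^ 2 / r + (1 - s) ^ 2 / r')).
    apply (@ex_derive_continuous R_AbsRing R_NormedModule); auto_derive; exact I. }
assert (P2 : forall s, 0 <= d * sqrt (s ^ 2 / r + (1 - s) ^ 2 / r')).
{ intros s; apply Rmult_le_pos; trivial; apply sqrt_pos. }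
destruct (Req_dec v w) as [E | N].
- destruct (Req_dec d 0) as [D | D].
  + exists 0; intros t; cbv beta.
    replace (0 * v + (1 - 0) * w) with w by lra.
    replace (t * v + (1 - t) * w) with w by (rewrite E; ring).
    rewrite D; lra.
  + apply coercive_min with (c := d / sqrt r) (k := 0); trivial.
    * apply Rdiv_lt_0_compat; [lra | apply sqrt_lt_R0; trivial].
    * intros s; cbv beta.
      assert (0 <= Rmax a (Rmax b (Rabs (s * v + (1 - s) * w) + m)))
        by (apply Rle_trans with (1 := Ha); apply Rmax_l).
      assert (Rabs s / sqrt r <= sqrt (s ^ 2 / r + (1 - s) ^ 2 / r')).
      { rewrite <- sqrt_Rsqr_abs, <- sqrt_div_alt by trivial.
        apply sqrt_le_1_alt; specialize (Hq s); unfold Rsqr in *; simpl in *; lra. }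
      unfold Rdiv in *; nra.
- apply coercive_min with (c := Rabs (v - w)) (k := Rabs w); trivial.
  + apply Rabs_pos_lt; lra.
  + intros s; cbv beta. specialize (P2 s).
    assert (Rabs (s * v + (1 - s) * w) + m
            <= Rmax a (Rmax b (Rabs (s * v + (1 - s) * w) + m)))
      by (eapply Rle_trans; [apply Rmax_r | apply Rmax_r]).
    assert (Rabs (v - w) * Rabs s - Rabs w <= Rabs (s * v + (1 - s) * w)).
    { rewrite <- Rabs_mult.
      replace (s * v + (1 - s) * w) with ((v - w) * s - - w) by ring.
      rewrite <- (Rabs_Ropp w); apply Rabs_triang_inv. }
    lra.
Qed.

Lemma speed_ge0 (p : R -> R -> R) (l : axis) (U : state) : 0 <= speed p l U.
Proof.
unfold speed; apply Rmult_le_pos; [|apply sqrt_pos].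
apply Rlt_le, Rinv_0_lt_compat, Rlt_sqrt2_0.
Qed.

Lemma alpha_is_min (p : R -> R -> R) (l : axis) (U U' : state) :
  admissible U -> admissible U' ->
  (exists s, alpha_sigma p l U U' s = alpha p l U U') /\
  (forall s, alpha p l U U' <= alpha_sigma p l U U' s).
Proof.
intros [Hr _] [Hr' _].
destruct (alpha_profile_min
  (Rabs (comp l (vel U)) + speed p l U) (Rabs (comp l (vel U')) + speed p l U')
  (Rmax (speed p l U) (speed p l U')) (comp l (vel U)) (comp l (vel U'))
  (vnorm (minus (mag U') (mag U)) / sqrt 2) (rho U) (rho U')) as [s0 H0]; trivial.
- apply Rplus_le_le_0_compat; [apply Rabs_pos | apply speed_ge0].
- apply Rle_trans with (1 := speed_ge0 p l U); apply Rmax_l.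
- apply Rdiv_le_0_compat; [apply sqrt_pos | apply Rlt_sqrt2_0].
- assert (E : alpha p l U U' = alpha_sigma p l U U' s0).
  { unfold alpha; rewrite (is_glb_Rbar_unique _ (Finite (alpha_sigma p l U U' s0))); trivial.
    split.
    - intros x [s ->]; exact (H0 s).
    - intros b Hb; apply Hb; exists s0; reflexivity. }
  rewrite E; split; [exists s0; reflexivity | exact H0].
Qed.

Definition LF_flux (p : R -> R -> R) (l : axis) (a : R) (Um Up : state) : state :=
  scal (/ 2) (minus (plus (flux p l Um) (flux p l Up)) (scal a (minus Up Um))).

Definition LF_step (p : R -> R -> R) (dx dy dt a1 a2 : R)
    (U : Z -> Z -> state) (i j : Z) : state :=
  minus
    (minus (U i j)
       (scal (dt / dx)
          (minus (LF_flux p ax1 a1 (U i j) (U (i + 1)%Z j))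
                 (LF_flux p ax1 a1 (U (i - 1)%Z j) (U i j)))))
    (scal (dt / dy)
       (minus (LF_flux p ax2 a2 (U i j) (U i (j + 1)%Z))
              (LF_flux p ax2 a2 (U i (j - 1)%Z) (U i j)))).

Definition discrete_div (dx dy : R) (U : Z -> Z -> state) (i j : Z) : R :=
  (comp ax1 (mag (U (i + 1)%Z j)) - comp ax1 (mag (U (i - 1)%Z j))) / (2 * dx)
  + (comp ax2 (mag (U i (j + 1)%Z)) - comp ax2 (mag (U i (j - 1)%Z))) / (2 * dy).

Definition DDF (dx dy : R) (U : Z -> Z -> state) : Prop :=
  forall i j : Z, discrete_div dx dy U i j = 0.

(* Suprema over all cells; they may be [p_infty]. *)
Definition sup_alpha1 (p : R -> R -> R) (U : Z -> Z -> state) : Rbar :=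
  Lub_Rbar (fun a => exists i j : Z, a = alpha p ax1 (U (i + 1)%Z j) (U (i - 1)%Z j)).

Definition sup_alpha2 (p : R -> R -> R) (U : Z -> Z -> state) : Rbar :=
  Lub_Rbar (fun a => exists i j : Z, a = alpha p ax2 (U i (j + 1)%Z) (U i (j - 1)%Z)).

Record fields : Type := mkFields {
  f_rho : R -> R -> R;
  f_mom : R -> R -> vec;
  f_mag : R -> R -> vec;
  f_rhoe : R -> R -> R
}.

Definition Ck (k : nat) (f : R -> R -> R) : Prop := forall x y, ex_diff_n f k x y.

Definition initial_fields (k : nat) (D : fields) : Prop :=
  (Ck k (f_rho D) /\
   (forall l, Ck k (fun x y => comp l (f_mom D x y))) /\
   (forall l, Ck k (fun x y => comp l (f_mag D x y))) /\
   Ck k (f_rhoe D)) /\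
  (forall x y, 0 < f_rho D x y) /\
  (forall x y, 0 < f_rhoe D x y) /\
  (forall x y, Derive (fun t => comp ax1 (f_mag D t y)) x
             + Derive (fun t => comp ax2 (f_mag D x t)) y = 0).

Definition total_energy (r re : R) (m B : vec) : R :=
  re + / 2 * (dot m m / r + dot B B).

Definition exact_state (D : fields) (x y : R) : state :=
  (f_rho D x y, f_mom D x y, f_mag D x y,
   total_energy (f_rho D x y) (f_rhoe D x y) (f_mom D x y) (f_mag D x y)).

(* Cell centers along one axis: [node o h i] is x_i (or y_i). *)
Definition node (o h : R) (i : Z) : R := o + IZR i * h.

(* Average over the cell of size [dx * dy] centered at [(xc, yc)]; for the
   continuous integrands considered here, the iterated integral is the double
   integral. *)
Definition cell_avg (dx dy xc yc : R) (f : R -> R -> R) : R :=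
  / (dx * dy) *
  RInt (fun x => RInt (fun y => f x y) (yc - dy / 2) (yc + dy / 2))
       (xc - dx / 2) (xc + dx / 2).

Definition init_state (dx dy ox oy : R) (D : fields) (i j : Z) : state :=
  let xn := node ox dx in
  let yn := node oy dy in
  let avg := cell_avg dx dy (xn i) (yn j) in
  let r := avg (f_rho D) in
  let m := vec_of (fun l => avg (fun x y => comp l (f_mom D x y))) in
  let B1 := / (2 * dy) *
    RInt (fun y => comp ax1 (f_mag D (xn i) y)) (yn (j - 1)%Z) (yn (j + 1)%Z) in
  let B2 := / (2 * dx) *
    RInt (fun x => comp ax2 (f_mag D x (yn j))) (xn (i - 1)%Z) (xn (i + 1)%Z) in
  let B3 := avg (fun x y => comp ax3 (f_mag D x y)) in
  let B : vec := (B1, B2, B3) in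
  let re := avg (f_rhoe D) in
  (r, m, B, total_energy r re m B).

(* Main.v *)
Require Import Defs.
From Stdlib Require Import Reals ZArith Lra ClassicalEpsilon.
From Coquelicot Require Import Coquelicot.
Import Defs.
Open Scope R_scope.

(** The scheme and the choice of initial data are treated separately.

    Preservation.  For a velocity V and a field b let
    n = (|V|^2/2, -V, -b, 1).  When rho > 0,
<<
      U.n + |b|^2/2 = rho |v - V|^2/2 + |B - b|^2/2 + rho e,
>>
    which is smallest at V = v, b = B, where it equals rho e.  Hence U is
    admissible exactly when rho > 0 and U.n + |b|^2/2 > 0 for all V and b:
    the nonlinear condition on the internal energy becomes a family of
    conditions that are affine in U.  The scheme is
<<
      U_ij^{n+1} = (1 - lambda) U_ij
        + dt/(2dx) [ a1 (U_{i+1,j} + U_{i-1,j}) - (F_1(U_{i+1,j}) - F_1(U_{i-1,j})) ]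
        + dt/(2dy) [ the same in the second direction ],
>>
    so it is enough to bound the bracket of one pair of opposite neighbours
    U, U' after taking the product with n ([LF_pair_gt0]).  In F_l(U).n the
    terms that couple v - V, the pressure and B - b form a quadratic form whose
    norm, relative to the energy above, is the fast magnetosonic speed
    ([fast_coupling_abs]).  The remaining dangerous term,
    V_l (|B - b|^2 - |B' - b|^2)/2, is unbounded in V; V_l is replaced by
    sigma v_l + (1 - sigma) v'_l up to the deviations v - V and v' - V, and the
    difference of squares is small with B - B'.  This costs exactly the last
    summand of alpha_sigma ([cross_term_le]).  What is left is
    - (B_l - B'_l)(V.b), which has no sign; summed over the two directions it
    is dt times the discrete divergence times V.b, hence zero.

    The discrete divergence of the new state is a combination of the old
    divergences at the cell and its four neighbours, plus mixed central
    differences of the electric field v_2 B_1 - v_1 B_2, which cancel because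
    central differences in x and in y commute ([LF_step_DDF]).

    Initial data.  The line averages of B_1 and B_2 make the discrete
    divergence equal, up to a factor, to the outward flux of the exact field
    through the boundary of a rectangle, which vanishes ([circulation_free]).
    Averages over symmetric intervals kill the linear Taylor term, so they are
    second-order accurate ([midpoint_rule]); the energy is a Lipschitz function
    of the averages as long as the density stays away from zero, which it does
    on compact sets ([total_energy_close]). *)

(** * Vectors and elementary inequalities *)

Lemma comp_plus l (u v : vec) : comp l (plus u v) = comp l u + comp l v.
Proof. destruct l; reflexivity. Qed.

Lemma comp_minus l (u v : vec) : comp l (minus u v) = comp l u - comp l v.
Proof. destruct l; reflexivity. Qed.

Lemma comp_scal l (a : R) (u : vec) : comp l (scal a u) = a * comp l u.
Proof. destruct l; reflexivity. Qed.

Lemma vec_ext (u v : vec) : (forall l, comp l u = comp l v) -> u = v.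
Proof.
intros H; destruct u as [[u1 u2] u3], v as [[v1 v2] v3].
f_equal; [f_equal|]; [apply (H ax1) | apply (H ax2) | apply (H ax3)].
Qed.

Lemma vec_minus_shift (u v b : vec) : minus (minus u b) (minus v b) = minus u v.
Proof. apply vec_ext; intros l; rewrite !comp_minus; ring. Qed.

Lemma dot_ge0 (u : vec) : 0 <= dot u u.
Proof. unfold dot; nra. Qed.

Lemma comp_sqr_le l (u : vec) : comp l u ^ 2 <= dot u u.
Proof. unfold dot; destruct l; nra. Qed.

Lemma dot_sqr_le (u v : vec) : dot u v ^ 2 <= dot u u * dot v v.
Proof.
unfold dot.
generalize (comp ax1 u) (comp ax2 u) (comp ax3 u) (comp ax1 v) (comp ax2 v) (comp ax3 v).
intros a b c x y z.
assert (H1 := pow2_ge_0 (a * y - b * x)).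
assert (H2 := pow2_ge_0 (a * z - c * x)).
assert (H3 := pow2_ge_0 (b * z - c * y)).
nra.
Qed.

Lemma Rle_of_sqr_le (x y : R) : 0 <= y -> x ^ 2 <= y ^ 2 -> x <= y.
Proof. intros Hy H; apply Rnot_lt_le; intros L; nra. Qed.

(** * The fast magnetosonic speed *)

(** Here a, k and t stand for the squared sound speed and for the squared
    longitudinal and transversal Alfven speeds.  The fast speed is the larger
    root of c^4 - (a + k + t) c^2 + a k = 0, and the product formula is this
    equation in the form in which a discriminant uses it.  Being the larger
    root makes the two factors have a nonnegative sum, and then both are
    nonnegative because their product is. *)
Lemma fast_speed_root (a k t c : R) :
  0 < a -> 0 <= k -> 0 <= t ->
  c = / sqrt 2 * sqrt (a + k + t + sqrt ((a + k + t) ^ 2 - 4 * (a * k))) ->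
  0 < c /\ 0 <= c ^ 2 - k /\ 0 <= c ^ 2 - a - t /\
  (c ^ 2 - a - t) * (c ^ 2 - k) = k * t.
Proof.
intros Ha Hk Ht Ec.
assert (Hd : 0 <= (a + k + t) ^ 2 - 4 * (a * k)).
{ assert (H := pow2_ge_0 (a - k)); nra. }
set (d := (a + k + t) ^ 2 - 4 * (a * k)) in *.
set (q := sqrt d) in *.
assert (Hq : 0 <= q) by apply sqrt_pos.
assert (Eq : q * q = d) by (apply sqrt_sqrt; exact Hd).
assert (H2 := Rlt_sqrt2_0).
assert (E2 : sqrt 2 * sqrt 2 = 2) by (apply sqrt_sqrt; lra).
assert (Ez : sqrt (a + k + t + q) * sqrt (a + k + t + q) = a + k + t + q)
  by (apply sqrt_sqrt; lra).
assert (Hz : 0 < sqrt (a + k + t + q)) by (apply sqrt_lt_R0; lra).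
assert (Ec2 : c ^ 2 = (a + k + t + q) / 2).
{ rewrite <- Ez, <- E2, Ec; field; lra. }
assert (Hprod : (c ^ 2 - a - t) * (c ^ 2 - k) = k * t).
{ rewrite Ec2; unfold d in Eq; nra. }
assert (Hsum : 0 <= (c ^ 2 - a - t) + (c ^ 2 - k)) by (rewrite Ec2; lra).
assert (Hkt : 0 <= k * t) by (apply Rmult_le_pos; assumption).
split; [rewrite Ec; apply Rmult_lt_0_compat; trivial; apply Rinv_0_lt_compat; trivial|].
clearbody d q.
assert (0 < c ^ 2 - k \/ c ^ 2 - k <= 0) as [P|P] by lra.
- repeat split; trivial; try lra. nra.
- assert (0 <= c ^ 2 - a - t) by lra.
  repeat split; trivial.
  destruct (Rle_lt_or_eq_dec _ _ P) as [Q|Q]; [|lra]. nra.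
Qed.

(** The discriminant criterion, with y in the place of the square of a second
    variable and z bounding the mixed term. *)
Lemma quadratic_form_ge0 (P Q x y z : R) :
  0 <= P -> 0 <= Q -> 0 <= y -> z ^ 2 <= P * Q * x ^ 2 * y ->
  0 <= P * x ^ 2 + Q * y + 2 * z.
Proof.
intros HP HQ Hy Hz.
assert (Hx := pow2_ge_0 x).
assert (H : - (2 * z) <= P * x ^ 2 + Q * y).
{ apply Rle_of_sqr_le; [nra|].
  assert (H := pow2_ge_0 (P * x ^ 2 - Q * y)). nra. }
lra.
Qed.

(** The core of the estimate, in coordinates whose first axis is the direction
    of the flux.  The left side is bilinear in the velocity deviation w and in
    (q, b), where q^2/(2r) is the internal energy and a q the pressure.
    Young's inequality removes q and b, and leaves a quadratic form in w that
    is nonnegative because its discriminant vanishes by the equation for the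
    fast speed c. *)
Lemma fast_coupling_aligned (r a q c w1 w2 w3 B1 B2 B3 b2 b3 : R) :
  0 < r -> 0 < c ->
  0 <= c ^ 2 - B1 ^ 2 / r -> 0 <= c ^ 2 - a ^ 2 - (B2 ^ 2 + B3 ^ 2) / r ->
  (c ^ 2 - a ^ 2 - (B2 ^ 2 + B3 ^ 2) / r) * (c ^ 2 - B1 ^ 2 / r)
    = B1 ^ 2 / r * ((B2 ^ 2 + B3 ^ 2) / r) ->
  w1 * (a * q) + b2 * (w1 * B2 - B1 * w2) + b3 * (w1 * B3 - B1 * w3)
  <= c * (r * (w1 ^ 2 + w2 ^ 2 + w3 ^ 2) / 2 + (b2 ^ 2 + b3 ^ 2) / 2 + q ^ 2 / (2 * r)).
Proof.
intros Hr Hc HQ HP E.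
set (P := c ^ 2 - a ^ 2 - (B2 ^ 2 + B3 ^ 2) / r) in *.
set (Q := c ^ 2 - B1 ^ 2 / r) in *.
assert (Hpos : 0 <= (r * P) * w1 ^ 2 + (r * Q) * (w2 ^ 2 + w3 ^ 2)
                    + 2 * (w1 * B1 * (B2 * w2 + B3 * w3))).
{ apply quadratic_form_ge0.
  - apply Rmult_le_pos; lra.
  - apply Rmult_le_pos; lra.
  - nra.
  - replace (r * P * (r * Q)) with (r * r * (P * Q)) by ring.
    rewrite E.
    replace (r * r * (B1 ^ 2 / r * ((B2 ^ 2 + B3 ^ 2) / r))) with (B1 ^ 2 * (B2 ^ 2 + B3 ^ 2))
      by (field; lra).
    assert (H : (B2 * w2 + B3 * w3) ^ 2 <= (B2 ^ 2 + B3 ^ 2) * (w2 ^ 2 + w3 ^ 2)).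
    { assert (H := pow2_ge_0 (B2 * w3 - B3 * w2)). nra. }
    assert (H' : 0 <= (w1 * B1) ^ 2) by apply pow2_ge_0.
    nra. }
(* The squares behind Young's inequality for the three products. *)
assert (Y0 := pow2_ge_0 (c * q - a * r * w1)).
assert (Y0' : 0 <= (c * q - a * r * w1) ^ 2 / r)
  by (apply Rmult_le_pos; [trivial | apply Rlt_le, Rinv_0_lt_compat; trivial]).
assert (Y2 := pow2_ge_0 (c * b2 - (w1 * B2 - B1 * w2))).
assert (Y3 := pow2_ge_0 (c * b3 - (w1 * B3 - B1 * w3))).
apply Rmult_le_reg_l with (2 * c); [lra|].
apply Rminus_le_0.
match goal with |- 0 <= ?X =>
replace X with
  ((c * q - a * r * w1) ^ 2 / r + (c * b2 - (w1 * B2 - B1 * w2)) ^ 2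
   + (c * b3 - (w1 * B3 - B1 * w3)) ^ 2
   + (r * P * w1 ^ 2 + r * Q * (w2 ^ 2 + w3 ^ 2) + 2 * (w1 * B1 * (B2 * w2 + B3 * w3))))
end.
- lra.
- unfold P, Q; field; lra.
Qed.

Section Scheme.

Variable p : R -> R -> R.
Hypothesis Hp : eos p.

(** The longitudinal component of b drops out of the left side, which is why
    only two of its components appear in the aligned estimate. *)
Lemma fast_coupling_le l (U : state) (w b : vec) :
  admissible U ->
  comp l w * pressure p U + comp l w * dot (mag U) b - comp l (mag U) * dot w b
  <= speed p l U * (rho U * dot w w / 2 + dot b b / 2 + calE U).
Proof.
intros [Hr HE].
set (q := rho U * sqrt (2 * sie U)).
assert (He : 0 < sie U) by (apply Rdiv_lt_0_compat; trivial).
assert (Hpr : 0 < pressure p U) by (apply Hp; trivial).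
assert (Hs : 0 < sqrt (2 * sie U)) by (apply sqrt_lt_R0; lra).
assert (Hq : 0 < q) by (apply Rmult_lt_0_compat; trivial).
assert (Ha : 0 < sound p U) by (apply Rdiv_lt_0_compat; trivial).
assert (Ep : pressure p U = sound p U * q) by (unfold sound, q in *; field; lra).
assert (Eq : calE U = q ^ 2 / (2 * rho U)).
{ unfold q. rewrite Rpow_mult_distr, pow2_sqrt by lra. unfold sie; field; lra. }
rewrite Ep, Eq.
destruct (fast_speed_root (sound p U ^ 2) (comp l (mag U) ^ 2 / rho U)
            ((dot (mag U) (mag U) - comp l (mag U) ^ 2) / rho U) (speed p l U))
  as (Hc & H1 & H2 & H3).
- apply pow_lt; trivial.
- apply Rmult_le_pos; [apply pow2_ge_0 | apply Rlt_le, Rinv_0_lt_compat; trivial].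
- apply Rmult_le_pos; [|apply Rlt_le, Rinv_0_lt_compat; trivial].
  assert (H := comp_sqr_le l (mag U)); lra.
- unfold speed; cbv zeta; do 2 f_equal; f_equal; [field; lra|].
  f_equal; field; lra.
- set (c := speed p l U) in *; clearbody c; clearbody q.
  unfold dot in *; destruct l; simpl comp in *;
  set (B1 := fst (fst (mag U))) in *; set (B2 := snd (fst (mag U))) in *;
  set (B3 := snd (mag U)) in *;
  set (w1 := fst (fst w)) in *; set (w2 := snd (fst w)) in *;
  set (w3 := snd w) in *;
  set (b1 := fst (fst b)) in *; set (b2 := snd (fst b)) in *;
  set (b3 := snd b) in *.
  + assert (E : B1 * B1 + B2 * B2 + B3 * B3 - B1 ^ 2 = B2 ^ 2 + B3 ^ 2) by ring.
    rewrite E in *.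
    generalize (fast_coupling_aligned (rho U) (sound p U) q c w1 w2 w3 B1 B2 B3 b2 b3
      Hr Hc H1 H2 H3).
    assert (0 <= c * b1 ^ 2) by (apply Rmult_le_pos; [lra | apply pow2_ge_0]). lra.
  + assert (E : B1 * B1 + B2 * B2 + B3 * B3 - B2 ^ 2 = B1 ^ 2 + B3 ^ 2) by ring.
    rewrite E in *.
    generalize (fast_coupling_aligned (rho U) (sound p U) q c w2 w1 w3 B2 B1 B3 b1 b3
      Hr Hc H1 H2 H3).
    assert (0 <= c * b2 ^ 2) by (apply Rmult_le_pos; [lra | apply pow2_ge_0]). lra.
  + assert (E : B1 * B1 + B2 * B2 + B3 * B3 - B3 ^ 2 = B1 ^ 2 + B2 ^ 2) by ring.
    rewrite E in *.
    generalize (fast_coupling_aligned (rho U) (sound p U) q c w3 w1 w2 B3 B1 B2 b1 b2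
      Hr Hc H1 H2 H3).
    assert (0 <= c * b3 ^ 2) by (apply Rmult_le_pos; [lra | apply pow2_ge_0]). lra.
Qed.

(** * Admissibility as a family of affine conditions *)

(** The scalar product of U with n = (|V|^2/2, -V, -b, 1). *)
Definition dot_normal (V b : vec) (U : state) : R :=
  rho U * (dot V V / 2) - dot V (mom U) - dot b (mag U) + ener U.

(** The total energy seen by an observer moving with velocity V in a background
    field b. *)
Definition relative_energy (V b : vec) (U : state) : R :=
  rho U * dot (minus (vel U) V) (minus (vel U) V) / 2
  + dot (minus (mag U) b) (minus (mag U) b) / 2 + calE U.

Lemma dot_normal_eq (V b : vec) (U : state) : 0 < rho U ->
  dot_normal V b U + dot b b / 2 = relative_energy V b U.
Proof.
intros Hr; unfold dot_normal, relative_energy, calE, vel, dot; rewrite !comp_minus, !comp_scal.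
field; lra.
Qed.

Lemma comp_unit k l : comp k (unit_vec l) =
  match k, l with ax1, ax1 | ax2, ax2 | ax3, ax3 => 1 | _, _ => 0 end.
Proof. destruct k, l; reflexivity. Qed.


Lemma fast_coupling_abs l (U : state) (w b : vec) :
  admissible U ->
  Rabs (comp l w * pressure p U + comp l w * dot (mag U) b - comp l (mag U) * dot w b)
  <= speed p l U * (rho U * dot w w / 2 + dot b b / 2 + calE U).
Proof.
intros HU; apply Rabs_le; split.
- assert (H := fast_coupling_le l U (scal (-1) w) b HU).
  unfold dot in *; rewrite !comp_scal in H; lra.
- apply fast_coupling_le; trivial.
Qed.

(** All terms of the flux are arranged around the deviations v - V and B - b.
    The first two terms are the ones that the energy cannot control: the second
    is the same for every state, so it disappears from differences of fluxes,
    and the first is compensated by the discrete divergence. *)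
Lemma dot_normal_flux (V b : vec) l (U : state) : 0 < rho U ->
  let v := vel U in
  let w := minus (vel U) V in
  let d := minus (mag U) b in
  dot_normal V b (flux p l U) =
    comp l (mag U) * dot V b - comp l V * (dot b b / 2)
    + comp l v * (rho U * dot w w / 2 + calE U) + comp l V * (dot d d / 2)
    + (comp l w * pressure p U + comp l w * dot (mag U) d - comp l (mag U) * dot w d).
Proof.
intros Hr; cbv zeta; unfold dot_normal.
set (v := vel U).
change (rho (flux p l U)) with (rho U * comp l v).
change (mom (flux p l U)) with
  (plus (minus (scal (rho U * comp l v) v) (scal (comp l (mag U)) (mag U)))
        (scal (ptot p U) (unit_vec l))).
change (mag (flux p l U)) with (minus (scal (comp l v) (mag U)) (scal (comp l (mag U)) v)).
change (ener (flux p l U)) with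
  (comp l v * (ener U + ptot p U) - comp l (mag U) * dot v (mag U)).
unfold v, ptot, calE, vel, dot.
rewrite !comp_plus, !comp_minus, !comp_scal, !comp_unit.
destruct l; field; lra.
Qed.

(** Two applications of the Cauchy-Schwarz inequality: in the pair of velocity
    deviations, with weights r and r', and in
    |d|^2 - |d'|^2 = (d - d').(d + d').  The arithmetic-geometric mean
    inequality then turns the product of the kinetic and magnetic energies into
    the square of their sum. *)
Lemma cross_term_le (l : axis) (r r' s : R) (w w' d d' : vec) :
  0 < r -> 0 < r' ->
  Rabs ((s * comp l w + (1 - s) * comp l w') * (dot d d / 2 - dot d' d' / 2))
  <= vnorm (minus d' d) / sqrt 2 * sqrt (s ^ 2 / r + (1 - s) ^ 2 / r')
     * (r * dot w w / 2 + r' * dot w' w' / 2 + dot d d / 2 + dot d' d' / 2).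
Proof.
intros Hr Hr'.
assert (H2 := Rlt_sqrt2_0).
assert (Hw := dot_ge0 w). assert (Hw' := dot_ge0 w').
assert (Hd := dot_ge0 d). assert (Hd' := dot_ge0 d').
set (K := r * dot w w / 2 + r' * dot w' w' / 2).
assert (HK : 0 <= K) by (unfold K; nra).
set (D := minus d' d).
assert (HD := dot_ge0 D).
assert (Hs : 0 <= s ^ 2 / r + (1 - s) ^ 2 / r').
{ apply Rplus_le_le_0_compat; apply Rdiv_le_0_compat; trivial; apply pow2_ge_0. }
set (S := s ^ 2 / r + (1 - s) ^ 2 / r') in *.
apply Rle_of_sqr_le.
- apply Rmult_le_pos; [|lra].
  apply Rmult_le_pos; [apply Rdiv_le_0_compat; trivial|]; apply sqrt_pos.
- rewrite pow2_abs.
  set (M := dot d d / 2 + dot d' d' / 2).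
  replace (K + dot d d / 2 + dot d' d' / 2) with (K + M) by (unfold M; ring).
  replace ((vnorm D / sqrt 2 * sqrt S * (K + M)) ^ 2)
    with (dot D D / 2 * S * (K + M) ^ 2).
  2:{ rewrite !Rpow_mult_distr, pow2_sqrt by trivial.
      unfold Rdiv; rewrite Rpow_mult_distr, pow_inv, pow2_sqrt by lra.
      unfold vnorm; rewrite pow2_sqrt by trivial. reflexivity. }
  rewrite Rpow_mult_distr.
  assert (Ht : (s * comp l w + (1 - s) * comp l w') ^ 2 <= 2 * S * K).
  { apply Rle_trans with (S * (r * comp l w ^ 2 + r' * comp l w' ^ 2)).
    - unfold S; apply Rminus_le_0.
      match goal with |- 0 <= ?X => replace X with
        ((s * r' * comp l w' - (1 - s) * r * comp l w) ^ 2 / (r * r')) by (field; lra) end.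
      apply Rdiv_le_0_compat; [apply pow2_ge_0 | nra].
    - assert (H := comp_sqr_le l w). assert (H' := comp_sqr_le l w').
      replace (2 * S * K) with (S * (r * dot w w + r' * dot w' w')) by (unfold K; field).
      apply Rmult_le_compat_l; trivial. nra. }
  assert (Hm : (dot d d / 2 - dot d' d' / 2) ^ 2 <= dot D D * M).
  { assert (H := dot_sqr_le D (plus d d')).
    replace (dot d d / 2 - dot d' d' / 2) with (- (dot D (plus d d') / 2))
      by (unfold D, dot; rewrite !comp_minus, !comp_plus; field).
    assert (H4 : dot (plus d d') (plus d d') <= 4 * M).
    { assert (H4 := dot_ge0 D). unfold M, D, dot in *.
      rewrite !comp_plus; rewrite !comp_minus in H4; lra. }
    nra. }
  apply Rle_trans with ((2 * S * K) * (dot D D * M)).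
  + apply Rmult_le_compat; trivial; apply pow2_ge_0.
  + replace (2 * S * K * (dot D D * M)) with (dot D D / 2 * S * (4 * K * M)) by field.
    apply Rmult_le_compat_l.
    * apply Rmult_le_pos; lra.
    * assert (H := pow2_ge_0 (K - M)); lra.
Qed.

(** * One pair of opposite neighbours *)

(** The key estimate.  Its last summand compensates the term of the flux that
    has no sign; it is linear in the normal component of the field, so it can
    be assembled over the directions into a discrete divergence. *)
Lemma LF_pair_gt0 l (U U' : state) (a s : R) (V b : vec) :
  admissible U -> admissible U' -> alpha_sigma p l U U' s < a ->
  0 < a * (dot_normal V b U + dot_normal V b U' + dot b b)
      - (dot_normal V b (flux p l U) - dot_normal V b (flux p l U'))
      + (comp l (mag U) - comp l (mag U')) * dot V b.
Proof.
intros HU HU' Ha.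
assert (X := fast_coupling_abs l U (minus (vel U) V) (minus (mag U) b) HU).
assert (X' := fast_coupling_abs l U' (minus (vel U') V) (minus (mag U') b) HU').
destruct HU as [Hr HE]; destruct HU' as [Hr' HE'].
rewrite (dot_normal_flux V b l U), (dot_normal_flux V b l U') by trivial.
cbv zeta.
assert (E := dot_normal_eq V b U Hr); assert (E' := dot_normal_eq V b U' Hr').
unfold relative_energy in E, E'.
assert (C := cross_term_le l (rho U) (rho U') s (minus (vel U) V) (minus (vel U') V)
  (minus (mag U) b) (minus (mag U') b) Hr Hr').
replace (minus (minus (mag U') b) (minus (mag U) b)) with (minus (mag U') (mag U)) in C.
2:{ symmetry; apply vec_minus_shift. }
unfold alpha_sigma in Ha.
set (x := vnorm (minus (mag U') (mag U)) / sqrt 2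
          * sqrt (s ^ 2 / rho U + (1 - s) ^ 2 / rho U')) in *.
set (w := minus (vel U) V) in *; set (w' := minus (vel U') V) in *.
set (d := minus (mag U) b) in *; set (d' := minus (mag U') b) in *.
assert (Ew : comp l w = comp l (vel U) - comp l V) by apply comp_minus.
assert (Ew' : comp l w' = comp l (vel U') - comp l V) by apply comp_minus.
set (Y := comp l w * pressure p U + _ - _) in *.
set (Y' := comp l w' * pressure p U' + _ - _) in *.
assert (HK := dot_ge0 w); assert (HK' := dot_ge0 w').
assert (HM := dot_ge0 d); assert (HM' := dot_ge0 d').
set (m := Rmax _ _) in Ha.
set (vs := s * comp l (vel U) + (1 - s) * comp l (vel U')) in *.
assert (B1 : Rabs (comp l (vel U)) + speed p l U <= m) by apply Rmax_l.
assert (B2 : Rabs (comp l (vel U')) + speed p l U' <= m)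
  by (eapply Rle_trans; [|apply Rmax_r]; apply Rmax_l).
assert (B3 : Rabs vs + Rmax (speed p l U) (speed p l U') <= m)
  by (eapply Rle_trans; [|apply Rmax_r]; apply Rmax_r).
assert (B4 := Rmax_l (speed p l U) (speed p l U')).
assert (B5 := Rmax_r (speed p l U) (speed p l U')).
clearbody m.
(* The velocity V_l of the test vector is sigma v_l + (1 - sigma) v'_l up to the
   same combination of the deviations. *)
assert (ET : s * comp l w + (1 - s) * comp l w' = vs - comp l V)
  by (rewrite Ew, Ew'; unfold vs; ring).
rewrite ET in C.
replace (dot_normal V b U + dot_normal V b U' + dot b b)
  with ((dot_normal V b U + dot b b / 2) + (dot_normal V b U' + dot b b / 2)) by field.
rewrite E, E'.
set (K := rho U * dot w w / 2) in *; set (K' := rho U' * dot w' w' / 2) in *.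
set (M := dot d d / 2) in *; set (M' := dot d' d' / 2) in *.
assert (0 <= K) by (unfold K; nra). assert (0 <= K') by (unfold K'; nra).
assert (0 <= M) by (unfold M; lra). assert (0 <= M') by (unfold M'; lra).
assert (0 <= x).
{ unfold x; apply Rmult_le_pos; [apply Rdiv_le_0_compat; [|apply Rlt_sqrt2_0]|];
  apply sqrt_pos. }
clearbody K K' M M' Y Y' x.
apply Rabs_le_between in X; apply Rabs_le_between in X'; apply Rabs_le_between in C.
set (v := comp l (vel U)) in *; set (v' := comp l (vel U')) in *.
set (c := speed p l U) in *; set (c' := speed p l U') in *.
set (e := calE U) in *; set (e' := calE U') in *.
assert (G1 : v * (K + e) <= Rabs v * (K + e))
  by (apply Rmult_le_compat_r; [lra | apply Rle_abs]).
assert (G2 : - v' * (K' + e') <= Rabs v' * (K' + e')).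
{ apply Rmult_le_compat_r; [lra|]. rewrite <- Rabs_Ropp; apply Rle_abs. }
assert (G3 : vs * M <= Rabs vs * M)
  by (apply Rmult_le_compat_r; [lra | apply Rle_abs]).
assert (G4 : - vs * M' <= Rabs vs * M').
{ apply Rmult_le_compat_r; [lra|]. rewrite <- Rabs_Ropp; apply Rle_abs. }
assert (G5 : 0 <= (m - Rabs v - c) * (K + e)) by (apply Rmult_le_pos; lra).
assert (G6 : 0 <= (m - Rabs v' - c') * (K' + e')) by (apply Rmult_le_pos; lra).
assert (G7 : 0 <= (m - Rabs vs - c) * M) by (apply Rmult_le_pos; lra).
assert (G8 : 0 <= (m - Rabs vs - c') * M') by (apply Rmult_le_pos; lra).
assert (G9 : 0 < (a - (m + x)) * (K + M + e + (K' + M' + e')))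
  by (apply Rmult_lt_0_compat; lra).
assert (G10 : 0 <= x * (e + e')) by (apply Rmult_le_pos; lra).
lra.
Qed.

(** * The scheme *)

(** Density, magnetic components and products with n are all read off the
    update through linearity alone. *)
Record linear_obs (f : state -> R) : Prop := {
  obs_plus : forall A B, f (plus A B) = f A + f B;
  obs_minus : forall A B, f (minus A B) = f A - f B;
  obs_scal : forall (k : R) A, f (scal k A) = k * f A }.

Lemma rho_linear : linear_obs rho.
Proof. split; reflexivity. Qed.

Lemma mag_linear l : linear_obs (fun A => comp l (mag A)).
Proof. split; intros; destruct l; reflexivity. Qed.

Lemma dot_normal_linear (V b : vec) : linear_obs (dot_normal V b).
Proof.
split; intros; unfold dot_normal, dot.
- change (rho (plus A B)) with (rho A + rho B).
  change (ener (plus A B)) with (ener A + ener B).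
  change (mom (plus A B)) with (plus (mom A) (mom B)).
  change (mag (plus A B)) with (plus (mag A) (mag B)).
  rewrite !comp_plus; field.
- change (rho (minus A B)) with (rho A - rho B).
  change (ener (minus A B)) with (ener A - ener B).
  change (mom (minus A B)) with (minus (mom A) (mom B)).
  change (mag (minus A B)) with (minus (mag A) (mag B)).
  rewrite !comp_minus; field.
- change (rho (scal k A)) with (k * rho A).
  change (ener (scal k A)) with (k * ener A).
  change (mom (scal k A)) with (scal k (mom A)).
  change (mag (scal k A)) with (scal k (mag A)).
  rewrite !comp_scal; field.
Qed.

(** The fluxes at the central cell cancel and its viscosity terms combine into
    the weight 1 - lambda, which the CFL condition makes nonnegative. *)
Lemma LF_step_obs (f : state -> R) (dx dy dt a1 a2 : R) (U : Z -> Z -> state) (i j : Z) :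
  linear_obs f -> 0 < dx -> 0 < dy ->
  f (LF_step p dx dy dt a1 a2 U i j) =
    (1 - (a1 * dt / dx + a2 * dt / dy)) * f (U i j)
    + dt / (2 * dx) * (a1 * (f (U (i + 1)%Z j) + f (U (i - 1)%Z j))
        - (f (flux p ax1 (U (i + 1)%Z j)) - f (flux p ax1 (U (i - 1)%Z j))))
    + dt / (2 * dy) * (a2 * (f (U i (j + 1)%Z) + f (U i (j - 1)%Z))
        - (f (flux p ax2 (U i (j + 1)%Z)) - f (flux p ax2 (U i (j - 1)%Z)))).
Proof.
intros Hf Hx Hy; unfold LF_step, LF_flux.
repeat (rewrite (obs_plus f Hf) || rewrite (obs_minus f Hf) || rewrite (obs_scal f Hf)).
field; lra.
Qed.

(** The minimum over V and b is attained at the velocity and the field of the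
    state itself. *)
Lemma calE_dot_normal (U : state) : 0 < rho U ->
  calE U = dot_normal (vel U) (mag U) U + dot (mag U) (mag U) / 2.
Proof.
intros Hr; rewrite dot_normal_eq by trivial; unfold relative_energy, dot.
rewrite !comp_minus; field.
Qed.

Lemma dot_normal_gt0 (V b : vec) (U : state) : admissible U -> 0 < dot_normal V b U + dot b b / 2.
Proof.
intros [Hr HE]; rewrite dot_normal_eq by trivial; unfold relative_energy.
assert (H := dot_ge0 (minus (vel U) V)); assert (H' := dot_ge0 (minus (mag U) b)).
nra.
Qed.

Lemma alpha_sigma_gt_vel l (U U' : state) (s a : R) :
  admissible U -> admissible U' -> alpha_sigma p l U U' s < a ->
  Rabs (comp l (vel U)) < a /\ Rabs (comp l (vel U')) < a.
Proof.
intros [Hr _] [Hr' _] Ha; unfold alpha_sigma in Ha.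
assert (0 <= vnorm (minus (mag U') (mag U)) / sqrt 2
             * sqrt (s ^ 2 / rho U + (1 - s) ^ 2 / rho U')).
{ apply Rmult_le_pos; [apply Rdiv_le_0_compat; [|apply Rlt_sqrt2_0]|]; apply sqrt_pos. }
assert (H1 := speed_ge0 p l U); assert (H2 := speed_ge0 p l U').
split.
- eapply Rle_lt_trans; [|exact Ha]. 
  match goal with |- _ <= Rmax ?x ?y + _ => assert (M := Rmax_l x y) end; lra.
- eapply Rle_lt_trans; [|exact Ha].
  match goal with |- _ <= Rmax ?x (Rmax ?y ?z) + _ =>
    assert (M := Rmax_r x (Rmax y z)); assert (M' := Rmax_l y z) end; lra.
Qed.

Lemma LF_pair_rho_gt0 l (U U' : state) (a s : R) :
  admissible U -> admissible U' -> alpha_sigma p l U U' s < a ->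
  0 < a * (rho U + rho U') - (rho (flux p l U) - rho (flux p l U')).
Proof.
intros HU HU' Ha.
destruct (alpha_sigma_gt_vel l U U' s a HU HU' Ha) as [H H'].
apply Rabs_def2 in H; apply Rabs_def2 in H'.
destruct HU as [Hr _]; destruct HU' as [Hr' _].
change (rho (flux p l U)) with (rho U * comp l (vel U)).
change (rho (flux p l U')) with (rho U' * comp l (vel U')).
nra.
Qed.

Lemma LF_step_admissible (dx dy dt a1 a2 : R) (U : Z -> Z -> state) (i j : Z) (s1 s2 : R) :
  0 < dx -> 0 < dy ->
  (forall i j, admissible (U i j)) ->
  discrete_div dx dy U i j = 0 ->
  alpha_sigma p ax1 (U (i + 1)%Z j) (U (i - 1)%Z j) s1 < a1 ->
  alpha_sigma p ax2 (U i (j + 1)%Z) (U i (j - 1)%Z) s2 < a2 ->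
  0 < a1 * dt / dx + a2 * dt / dy <= 1 ->
  admissible (LF_step p dx dy dt a1 a2 U i j).
Proof.
intros Hx Hy HU Hdiv H1 H2 Hcfl.
(* Both a1 and a2 are positive, so the CFL condition determines the sign of dt. *)
assert (Hdt : 0 < dt).
{ destruct (alpha_sigma_gt_vel _ _ _ _ _ (HU _ _) (HU _ _) H1) as [A1 _].
  destruct (alpha_sigma_gt_vel _ _ _ _ _ (HU _ _) (HU _ _) H2) as [A2 _].
  assert (P1 := Rle_lt_trans _ _ _ (Rabs_pos _) A1).
  assert (P2 := Rle_lt_trans _ _ _ (Rabs_pos _) A2).
  assert (0 < a1 / dx + a2 / dy).
  { apply Rplus_lt_0_compat; apply Rdiv_lt_0_compat; trivial. }
  replace (a1 * dt / dx + a2 * dt / dy) with ((a1 / dx + a2 / dy) * dt) in Hcfl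
    by (field; lra).
  apply Rmult_lt_reg_l with (a1 / dx + a2 / dy); lra. }
assert (Cx : 0 < dt / (2 * dx)) by (apply Rdiv_lt_0_compat; lra).
assert (Cy : 0 < dt / (2 * dy)) by (apply Rdiv_lt_0_compat; lra).
assert (Hr : 0 < rho (LF_step p dx dy dt a1 a2 U i j)).
{ rewrite (LF_step_obs rho) by (trivial; apply rho_linear).
  assert (R1 := LF_pair_rho_gt0 _ _ _ _ _ (HU _ _) (HU _ _) H1).
  assert (R2 := LF_pair_rho_gt0 _ _ _ _ _ (HU _ _) (HU _ _) H2).
  destruct (HU i j) as [R0 _].
  apply (Rmult_lt_0_compat _ _ Cx) in R1; apply (Rmult_lt_0_compat _ _ Cy) in R2.
  assert (0 <= (1 - (a1 * dt / dx + a2 * dt / dy)) * rho (U i j))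
    by (apply Rmult_le_pos; lra).
  lra. }
split; trivial.
rewrite calE_dot_normal by trivial.
(* The remaining inequality holds for all V and b, not only for the velocity and
   the field of the new state. *)
generalize (vel (LF_step p dx dy dt a1 a2 U i j)) (mag (LF_step p dx dy dt a1 a2 U i j)).
intros V b.
rewrite (LF_step_obs (dot_normal V b)) by (trivial; apply dot_normal_linear).
assert (S1 := LF_pair_gt0 _ _ _ _ _ V b (HU _ _) (HU _ _) H1).
assert (S2 := LF_pair_gt0 _ _ _ _ _ V b (HU _ _) (HU _ _) H2).
assert (S0 := dot_normal_gt0 V b (U i j) (HU i j)).
apply (Rmult_lt_0_compat _ _ Cx) in S1; apply (Rmult_lt_0_compat _ _ Cy) in S2.
assert (S0' : 0 <= (1 - (a1 * dt / dx + a2 * dt / dy)) * (dot_normal V b (U i j) + dot b b / 2))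
  by (apply Rmult_le_pos; lra).
(* The terms without sign from the two directions add up to this product. *)
assert (D : dt * dot V b * discrete_div dx dy U i j = 0) by (rewrite Hdiv; ring).
unfold discrete_div in D.
match goal with |- 0 < ?X => match type of S0' with _ <= ?Y0 =>
  match type of S1 with _ < ?Y1 => match type of S2 with _ < ?Y2 =>
  match type of D with ?Y3 = _ => replace X with (Y0 + Y1 + Y2 - Y3) by (field; lra)
  end end end end end.
lra.
Qed.

Lemma comp_mag_flux k l (U : state) :
  comp k (mag (flux p l U))
  = comp l (vel U) * comp k (mag U) - comp l (mag U) * comp k (vel U).
Proof.
change (mag (flux p l U))
  with (minus (scal (comp l (vel U)) (mag U)) (scal (comp l (mag U)) (vel U))).
rewrite comp_minus, !comp_scal; reflexivity.
Qed.

(** The Lax-Friedrichs viscosity acts by averages that commute with the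
    discrete divergence, and [comp_mag_flux] is antisymmetric in its two axes,
    so the fluxes enter only through mixed central differences of one scalar,
    with opposite signs. *)
Lemma LF_step_DDF (dx dy dt a1 a2 : R) (U : Z -> Z -> state) :
  0 < dx -> 0 < dy -> DDF dx dy U ->
  DDF dx dy (LF_step p dx dy dt a1 a2 U).
Proof.
intros Hx Hy HU i j.
unfold discrete_div.
rewrite !(LF_step_obs (fun A => comp ax1 (mag A))) by (trivial; apply mag_linear).
rewrite !(LF_step_obs (fun A => comp ax2 (mag A))) by (trivial; apply mag_linear).
rewrite !comp_mag_flux.
assert (D0 := HU i j).
assert (D1 := HU (i + 1)%Z j). assert (D2 := HU (i - 1)%Z j).
assert (D3 := HU i (j + 1)%Z). assert (D4 := HU i (j - 1)%Z).
transitivity ((1 - (a1 * dt / dx + a2 * dt / dy)) * discrete_div dx dy U i j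
  + a1 * dt / (2 * dx)
    * (discrete_div dx dy U (i + 1)%Z j + discrete_div dx dy U (i - 1)%Z j)
  + a2 * dt / (2 * dy)
    * (discrete_div dx dy U i (j + 1)%Z + discrete_div dx dy U i (j - 1)%Z)).
2:{ rewrite D0, D1, D2, D3, D4; ring. }
clear - Hx Hy; unfold discrete_div.
replace (i + 1 - 1)%Z with i by ring; replace (i - 1 + 1)%Z with i by ring.
replace (j + 1 - 1)%Z with j by ring; replace (j - 1 + 1)%Z with j by ring.
field; lra.
Qed.

(** The strict bound by the supremum passes to some sigma at every pair since
    the minimum over sigma is attained. *)
Lemma sup_lt_sigma l (E : R -> Prop) (U U' : state) (a : R) :
  admissible U -> admissible U' -> E (alpha p l U U') -> Rbar_lt (Lub_Rbar E) a ->
  exists s, alpha_sigma p l U U' s < a.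
Proof.
intros HU HU' HE Ha.
destruct (alpha_is_min p l U U' HU HU') as [[s Es] _].
exists s; rewrite Es.
exact (Rbar_le_lt_trans _ _ _ (proj1 (Lub_Rbar_correct E) _ HE) Ha).
Qed.

End Scheme.

Lemma LF_scheme_preserves (p : R -> R -> R) (dx dy : R) (dt a1 a2 : nat -> R)
    (U : nat -> Z -> Z -> state) :
  eos p -> 0 < dx -> 0 < dy ->
  (forall (n : nat) (i j : Z),
     U (S n) i j = LF_step p dx dy (dt n) (a1 n) (a2 n) (U n) i j) ->
  (forall i j : Z, admissible (U O i j)) ->
  DDF dx dy (U O) ->
  (forall n : nat, Rbar_lt (sup_alpha1 p (U n)) (a1 n)) ->
  (forall n : nat, Rbar_lt (sup_alpha2 p (U n)) (a2 n)) ->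
  (forall n : nat, 0 < a1 n * dt n / dx + a2 n * dt n / dy <= 1) ->
  forall n : nat, (forall i j : Z, admissible (U n i j)) /\ DDF dx dy (U n).
Proof.
intros Hp Hx Hy Hstep HG HD H1 H2 Hcfl n; induction n as [|n [IG ID]].
- split; trivial.
- split.
  + intros i j; rewrite Hstep.
    destruct (sup_lt_sigma p ax1 _ _ _ (a1 n) (IG (i + 1)%Z j) (IG (i - 1)%Z j)
      (ex_intro _ i (ex_intro _ j eq_refl)) (H1 n)) as [s1 S1].
    destruct (sup_lt_sigma p ax2 _ _ _ (a2 n) (IG i (j + 1)%Z) (IG i (j - 1)%Z)
      (ex_intro _ i (ex_intro _ j eq_refl)) (H2 n)) as [s2 S2].
    apply LF_step_admissible with s1 s2; trivial.
  + assert (D := LF_step_DDF p dx dy (dt n) (a1 n) (a2 n) (U n) Hx Hy ID).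
    intros i j; specialize (D i j); unfold discrete_div in *.
    rewrite !Hstep; exact D.
Qed.

(** * Functions of two variables of class C^k *)

Lemma continuity_2d_fst (f : R -> R -> R) (x y : R) :
  continuity_2d_pt f x y -> continuous (fun t => f t y) x.
Proof.
intros H; apply continuity_pt_filterlim, continuity_pt_locally.
intros eps; destruct (H eps) as [d Hd]; exists d; intros t Ht.
apply Hd; [exact Ht|]. rewrite Rminus_diag, Rabs_R0; apply cond_pos.
Qed.

Lemma continuity_2d_snd (f : R -> R -> R) (x y : R) :
  continuity_2d_pt f x y -> continuous (fun t => f x t) y.
Proof.
intros H; apply continuity_pt_filterlim, continuity_pt_locally.
intros eps; destruct (H eps) as [d Hd]; exists d; intros t Ht.
apply Hd; [|exact Ht]. rewrite Rminus_diag, Rabs_R0; apply cond_pos.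
Qed.

Lemma Ck_continuity k f : Ck k f -> forall x y, continuity_2d_pt f x y.
Proof. intros H x y; specialize (H x y); destruct k; apply H. Qed.

Lemma Ck_Derive_fst k f : Ck (S k) f -> Ck k (fun x y => Derive (fun z => f z y) x).
Proof. intros H x y; apply (H x y). Qed.

Lemma Ck_Derive_snd k f : Ck (S k) f -> Ck k (fun x y => Derive (fun z => f x z) y).
Proof. intros H x y; apply (H x y). Qed.

Lemma Ck_ex_derive_fst k f : Ck (S k) f -> forall x y, ex_derive (fun z => f z y) x.
Proof. intros H x y; apply (H x y). Qed.

Lemma Ck_ex_derive_snd k f : Ck (S k) f -> forall x y, ex_derive (fun z => f x z) y.
Proof. intros H x y; apply (H x y). Qed.

Lemma Ck_pred k f : Ck (S k) f -> Ck k f.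
Proof.
revert f; induction k as [|k IH]; intros f H x y.
- split; trivial; apply (H x y).
- destruct (H x y) as (H0 & H1 & H2 & _).
  split; [exact H0|]. split; [exact H1|]. split; [exact H2|]. split.
  + apply (IH _ (Ck_Derive_fst _ _ H) x y).
  + apply (IH _ (Ck_Derive_snd _ _ H) x y).
Qed.

Lemma ex_RInt_cont (g : R -> R) (a b : R) : (forall x, continuous g x) -> ex_RInt g a b.
Proof. intros H; apply (ex_RInt_continuous (V := R_CompleteNormedModule)); auto. Qed.

Lemma is_derive_RInt_C1 (f : R -> R -> R) (c d x : R) : Ck 1 f ->
  is_derive (fun x => RInt (fun y => f x y) c d) x
    (RInt (fun y => Derive (fun u => f u y) x) c d).
Proof.
intros Hf; apply (is_derive_RInt_param f c d x).
- apply filter_forall; intros t y _; apply (Ck_ex_derive_fst 0 f Hf).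
- intros t _; apply (Ck_continuity 0), Ck_Derive_fst; exact Hf.
- apply filter_forall; intros t; apply ex_RInt_cont; intros y.
  apply continuity_2d_snd, (Ck_continuity 1 f Hf).
Qed.

Lemma continuous_RInt_C1 (f : R -> R -> R) (c d x : R) : Ck 1 f ->
  continuous (fun x => RInt (fun y => f x y) c d) x.
Proof.
intros Hf; apply (@ex_derive_continuous R_AbsRing R_NormedModule).
eexists; apply (is_derive_RInt_C1 f c d x Hf).
Qed.

(** The left side is the flux of (f, g) out of the rectangle.  As a function of
    the abscissa of the right-hand side of the rectangle it has derivative
    zero: differentiation under the integral turns the first flux into the
    integral of the x-derivative of f, which is minus the y-derivative of g.
    This avoids exchanging the order of a double integral. *)
Lemma circulation_free (f g : R -> R -> R) (a b c d : R) :
  Ck 1 f -> Ck 1 g -> a < b ->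
  (forall x y, Derive (fun t => f t y) x + Derive (fun t => g x t) y = 0) ->
  RInt (fun y => f b y) c d - RInt (fun y => f a y) c d
  + (RInt (fun x => g x d) a b - RInt (fun x => g x c) a b) = 0.
Proof.
intros Hf Hg Hab Hdiv.
assert (Cg : forall y x, continuous (fun x => g x y) x)
  by (intros y x; apply continuity_2d_fst, (Ck_continuity 1 g Hg)).
set (F := fun t => plus (RInt (fun y => f t y) c d) (RInt (fun x => g x d - g x c) a t)).
assert (E : F a = F b).
{ apply (eq_is_derive (V := R_NormedModule)); trivial.
  intros t _.
  replace (@zero R_NormedModule) with
   (plus (RInt (fun y => Derive (fun u => f u y) t) c d) (g t d - g t c)).
  - apply (is_derive_plus (V := R_NormedModule)).
    + apply is_derive_RInt_C1; trivial.
    + apply (is_derive_RInt (V := R_NormedModule) (fun x => g x d - g x c) _ a).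
      * apply filter_forall; intros s; apply (RInt_correct (V := R_CompleteNormedModule)).
        apply ex_RInt_cont; intros x.
        apply (continuous_minus (fun x => g x d) (fun x => g x c)); apply Cg.
      * apply (continuous_minus (fun x => g x d) (fun x => g x c)); apply Cg.
  - rewrite <- (RInt_Derive (fun y => g t y) c d).
    + change (@zero R_NormedModule) with 0.
      rewrite (RInt_ext _ (fun y => opp (Derive (fun v => g t v) y))).
      * rewrite (RInt_opp (V := R_CompleteNormedModule)).
        { apply (plus_opp_l (G := R_AbelianGroup)). }
        apply ex_RInt_cont; intros y.
        apply (continuity_2d_snd (fun t y => Derive (fun v => g t v) y)).
        apply (Ck_continuity 0), Ck_Derive_snd; exact Hg.
      * intros y _; change (opp ?z) with (- z); specialize (Hdiv t y). lra.
    + intros y _; apply (Ck_ex_derive_snd 0 g Hg).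
    + intros y _; apply (continuity_2d_snd (fun t y => Derive (fun v => g t v) y)).
      apply (Ck_continuity 0), Ck_Derive_snd; exact Hg. }
unfold F in E; rewrite RInt_point in E.
rewrite (RInt_minus (V := R_CompleteNormedModule) (fun x => g x d) (fun x => g x c)) in E
  by (apply ex_RInt_cont; apply Cg).
unfold minus, plus, opp, zero in E; simpl in E. lra.
Qed.

(** * Initial data: admissibility and discrete divergence *)

Lemma node_succ o h i : node o h (i + 1)%Z = node o h i + h.
Proof. unfold node; rewrite plus_IZR; ring. Qed.

Lemma node_pred o h i : node o h (i - 1)%Z = node o h i - h.
Proof. unfold node; rewrite minus_IZR; ring. Qed.

Lemma cell_avg_gt0 (dx dy xc yc : R) (f : R -> R -> R) :
  0 < dx -> 0 < dy -> Ck 1 f -> (forall x y, 0 < f x y) ->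
  0 < cell_avg dx dy xc yc f.
Proof.
intros Hx Hy Hf Hpos; unfold cell_avg.
apply Rmult_lt_0_compat; [apply Rinv_0_lt_compat, Rmult_lt_0_compat; trivial|].
apply RInt_gt_0; [lra | | intros; apply continuous_RInt_C1; trivial].
intros x _; apply RInt_gt_0; [lra | auto |].
intros y _; apply continuity_2d_snd, (Ck_continuity 1 f Hf).
Qed.

Lemma init_state_admissible dx dy ox oy D i j :
  initial_fields 1 D -> 0 < dx -> 0 < dy ->
  admissible (init_state dx dy ox oy D i j).
Proof.
intros ((Hr & _ & _ & He) & Pr & Pe & _) Hx Hy.
split.
- apply cell_avg_gt0; trivial.
- replace (calE _) with (cell_avg dx dy (node ox dx i) (node oy dy j) (f_rhoe D)).
  + apply cell_avg_gt0; trivial.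
  + unfold calE, init_state, total_energy; cbv zeta.
    unfold ener at 1, mom, rho, mag; cbn [fst snd]. ring.
Qed.

Lemma init_state_DDF dx dy ox oy D :
  initial_fields 1 D -> 0 < dx -> 0 < dy ->
  DDF dx dy (init_state dx dy ox oy D).
Proof.
intros ((_ & _ & HB & _) & _ & _ & Hdiv) Hx Hy i j.
unfold discrete_div, init_state, mag; cbv zeta; cbn [fst snd comp].
rewrite !node_succ, !node_pred.
set (x := node ox dx i); set (y := node oy dy j).
assert (G := circulation_free (fun x y => comp ax1 (f_mag D x y))
  (fun x y => comp ax2 (f_mag D x y)) (x - dx) (x + dx) (y - dy) (y + dy)
  (HB ax1) (HB ax2) ltac:(lra) Hdiv).
cbn [comp] in G.
apply (f_equal (Rmult (/ (4 * dx * dy)))) in G; rewrite Rmult_0_r in G; rewrite <- G.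
field; lra.
Qed.

(** * Second-order accuracy of averages *)

Definition line_avg (c h : R) (g : R -> R) : R := / (2 * h) * RInt g (c - h) (c + h).

Lemma line_avg_close (c h e : R) (f g : R -> R) :
  0 < h -> (forall x, continuous f x) -> (forall x, continuous g x) ->
  (forall x, Rabs (x - c) <= h -> Rabs (f x - g x) <= e) ->
  Rabs (line_avg c h f - line_avg c h g) <= e.
Proof.
intros Hh Hf Hg He; unfold line_avg.
rewrite <- Rmult_minus_distr_l.
assert (E := RInt_minus (V := R_CompleteNormedModule) f g (c - h) (c + h)
  (ex_RInt_cont _ _ _ Hf) (ex_RInt_cont _ _ _ Hg)).
change (minus (RInt f ?a ?b) ?z) with (RInt f a b - z) in E; rewrite <- E.
assert (P : 0 < / (2 * h)) by (apply Rinv_0_lt_compat; lra).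
rewrite Rabs_mult, (Rabs_pos_eq (/ (2 * h))) by lra.
replace e with (/ (2 * h) * ((c + h - (c - h)) * e)) by (field; lra).
apply Rmult_le_compat_l; [lra|].
apply abs_RInt_le_const; [lra | |].
- apply ex_RInt_cont; intros x; apply (continuous_minus f g); trivial.
- intros t Ht; apply He, Rabs_le; lra.
Qed.

(** The linear term integrates to zero because the interval is symmetric about
    c; this is what raises the accuracy to second order. *)
Lemma line_avg_affine (c h k l : R) : 0 < h ->
  line_avg c h (fun x => k + l * (x - c)) = k.
Proof.
intros Hh; unfold line_avg.
rewrite (is_RInt_unique _ _ _ (2 * h * k)); [field; lra|].
set (F := fun x => k * x + l * (x - c) ^ 2 / 2).
replace (2 * h * k) with (F (c + h) - F (c - h)) by (unfold F; field).
apply (is_RInt_derive (V := R_CompleteNormedModule) F).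
- intros x _; unfold F; auto_derive; trivial; field.
- intros x _; apply (@ex_derive_continuous R_AbsRing R_NormedModule); auto_derive; trivial.
Qed.

Lemma MVT_abs_le (g : R -> R) (c x C : R) :
  (forall t, ex_derive g t) ->
  (forall t, Rabs (t - c) <= Rabs (x - c) -> Rabs (Derive g t) <= C) ->
  Rabs (g x - g c) <= C * Rabs (x - c).
Proof.
intros Hg HC.
destruct (MVT_gen g c x (Derive g)) as [t [Ht E]].
- intros t _; apply Derive_correct; trivial.
- intros t _; apply continuity_pt_filterlim,
    (@ex_derive_continuous R_AbsRing R_NormedModule); trivial.
- rewrite E, Rabs_mult; apply Rmult_le_compat_r; [apply Rabs_pos|].
  apply HC. revert Ht; unfold Rmin, Rmax, Rabs.
  destruct (Rle_dec c x); destruct (Rcase_abs (t - c)); destruct (Rcase_abs (x - c)); lra.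
Qed.

(** The average of g is compared with that of its tangent line at c; the mean
    value theorem, applied twice, bounds their distance. *)
Lemma midpoint_rule (g : R -> R) (c h C : R) :
  0 < h -> (forall x, ex_derive g x) -> (forall x, ex_derive (Derive g) x) ->
  (forall x, Rabs (x - c) <= h -> Rabs (Derive (Derive g) x) <= C) ->
  Rabs (line_avg c h g - g c) <= C * h ^ 2.
Proof.
intros Hh H1 H2 HC.
assert (C0 : 0 <= C).
{ apply Rle_trans with (2 := HC c ltac:(rewrite Rminus_diag, Rabs_R0; lra)).
  apply Rabs_pos. }
rewrite <- (line_avg_affine c h (g c) (Derive g c)) by trivial.
apply line_avg_close; trivial.
- intros x; apply (@ex_derive_continuous R_AbsRing R_NormedModule); trivial.
- intros x; apply (@ex_derive_continuous R_AbsRing R_NormedModule); auto_derive; trivial.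
- intros x Hx.
  assert (D : forall t, is_derive (fun t => g t - Derive g c * (t - c)) t
                (Derive g t - Derive g c)).
  { intros t; auto_derive; [apply H1 | rewrite Rmult_1_l, Rmult_1_r; reflexivity]. }
  assert (B := MVT_abs_le (fun t => g t - Derive g c * (t - c)) c x (C * h)).
  replace (g x - (g c + Derive g c * (x - c)))
    with (g x - Derive g c * (x - c) - (g c - Derive g c * (c - c))) by ring.
  apply Rle_trans with (C * h * Rabs (x - c)).
  + apply B.
    * intros t; eexists; apply D.
    * intros t Ht; replace (Derive _ t) with (Derive g t - Derive g c)
        by (symmetry; apply is_derive_unique, D).
      apply Rle_trans with (C * Rabs (t - c)); [|apply Rmult_le_compat_l; lra].
      apply MVT_abs_le; trivial. intros s Hs; apply HC; lra.
  + replace (C * h ^ 2) with (C * h * h) by ring.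
    apply Rmult_le_compat_l; trivial. apply Rmult_le_pos; lra.
Qed.

(** At each point take a radius on which f varies by less than 1 and which is
    also at most 1/(1 + |f|) there.  Compactness bounds these radii below by
    some d at suitable points near any (x, y), so |f| is at most 1/d at those
    points. *)
Lemma continuous_2d_bounded (f : R -> R -> R) (r : R) :
  (forall x y, continuity_2d_pt f x y) ->
  exists K, forall x y, Rabs x <= r -> Rabs y <= r -> Rabs (f x y) <= K.
Proof.
intros Hf.
assert (Hd : forall x y, exists d : posreal, d <= / (1 + Rabs (f x y)) /\
  forall u v, Rabs (u - x) < d -> Rabs (v - y) < d -> Rabs (f u v - f x y) < 1).
{ intros x y; destruct (Hf x y (mkposreal 1 Rlt_0_1)) as [d Hd].
  assert (P : 0 < / (1 + Rabs (f x y)))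
    by (apply Rinv_0_lt_compat; assert (H := Rabs_pos (f x y)); lra).
  assert (Q : 0 < Rmin d (/ (1 + Rabs (f x y)))) by (apply Rmin_pos; [apply cond_pos | trivial]).
  exists (mkposreal _ Q); split; [apply Rmin_r|].
  simpl; intros u v Hu Hv; apply Hd; eapply Rlt_le_trans; try eassumption; apply Rmin_l. }
set (delta x y := constructive_indefinite_description _ (Hd x y)).
destruct (compactness_value_2d (- r) r (- r) r (fun x y => proj1_sig (delta x y))) as [d D].
exists (/ d + 1); intros x y Hx Hy.
apply Rabs_le_between in Hx; apply Rabs_le_between in Hy.
apply Rnot_lt_le; intros L; apply (D x y Hx Hy).
intros (u & v & _ & _ & Hu & Hv & Hdu).
destruct (delta u v) as [e [H1 H2]]; simpl in Hu, Hv, Hdu.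
specialize (H2 x y Hu Hv).
assert (P := Rabs_pos (f u v)).
assert (H3 : 1 + Rabs (f u v) <= / d).
{ rewrite <- (Rinv_inv (1 + Rabs (f u v))).
  apply Rinv_le_contravar; [apply cond_pos | lra]. }
assert (H4 := Rabs_triang_inv (f x y) (f u v)). lra.
Qed.

Lemma line_avg_ge (g : R -> R) (c h k : R) :
  0 < h -> (forall x, continuous g x) -> (forall x, Rabs (x - c) <= h -> k <= g x) ->
  k <= line_avg c h g.
Proof.
intros Hh Hg Hk; unfold line_avg.
replace k with (/ (2 * h) * ((c + h - (c - h)) * k)) by (field; lra).
apply Rmult_le_compat_l; [apply Rlt_le, Rinv_0_lt_compat; lra|].
change ((c + h - (c - h)) * k) with (scal (c + h - (c - h)) k).
rewrite <- (RInt_const (V := R_CompleteNormedModule)).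
apply RInt_le; [lra | apply ex_RInt_const | apply ex_RInt_cont; trivial |].
intros x Hx; apply Hk, Rabs_le; lra.
Qed.

Lemma line_avg_continuous (f : R -> R -> R) (c h x : R) : Ck 1 f ->
  continuous (fun x => line_avg c h (fun y => f x y)) x.
Proof.
intros Hf; unfold line_avg.
apply (continuous_scal_r (/ (2 * h)) (fun x => RInt (fun y => f x y) (c - h) (c + h))).
apply continuous_RInt_C1; trivial.
Qed.

Lemma cell_avg_line_avg (dx dy xc yc : R) (f : R -> R -> R) :
  0 < dx -> 0 < dy -> Ck 1 f ->
  cell_avg dx dy xc yc f
  = line_avg xc (dx / 2) (fun x => line_avg yc (dy / 2) (fun y => f x y)).
Proof.
intros Hx Hy Hf; unfold cell_avg, line_avg.
assert (E := RInt_scal (V := R_CompleteNormedModule)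
  (fun x => RInt (fun y => f x y) (yc - dy / 2) (yc + dy / 2))
  (xc - dx / 2) (xc + dx / 2) (/ (2 * (dy / 2)))
  (ex_RInt_cont _ _ _ (fun x => continuous_RInt_C1 f _ _ x Hf))).
unfold scal in E; simpl in E; unfold mult in E; simpl in E.
rewrite E; field; lra.
Qed.

Lemma Rabs_le_shift (x c h r : R) : Rabs (x - c) <= h -> Rabs c <= r -> Rabs x <= r + h.
Proof.
intros H1 H2; replace x with (x - c + c) by ring.
eapply Rle_trans; [apply Rabs_triang | lra].
Qed.

Lemma line_avg_second_order (f : R -> R -> R) (r : R) : Ck 2 f ->
  exists K, 0 <= K /\ forall h x y, 0 < h <= 1 -> Rabs x <= r -> Rabs y <= r ->
    Rabs (line_avg x h (fun t => f t y) - f x y) <= K * h ^ 2 /\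
    Rabs (line_avg y h (fun t => f x t) - f x y) <= K * h ^ 2.
Proof.
intros Hf.
assert (D1 := Ck_Derive_fst 0 _ (Ck_Derive_fst 1 _ Hf)).
assert (D2 := Ck_Derive_snd 0 _ (Ck_Derive_snd 1 _ Hf)).
destruct (continuous_2d_bounded _ (r + 1) (Ck_continuity 0 _ D1)) as [K1 H1].
destruct (continuous_2d_bounded _ (r + 1) (Ck_continuity 0 _ D2)) as [K2 H2].
exists (Rmax 0 (Rmax K1 K2)); split; [apply Rmax_l|].
assert (L1 : K1 <= Rmax 0 (Rmax K1 K2)) by (eapply Rle_trans; [|apply Rmax_r]; apply Rmax_l).
assert (L2 : K2 <= Rmax 0 (Rmax K1 K2)) by (eapply Rle_trans; [|apply Rmax_r]; apply Rmax_r).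
intros h x y Hh Hx Hy; split.
- apply (midpoint_rule (fun t => f t y)); [lra | | |].
  + intros t; apply (Ck_ex_derive_fst 1 f Hf).
  + intros t; apply (Ck_ex_derive_fst 0 _ (Ck_Derive_fst 1 f Hf)).
  + intros t Ht; apply Rle_trans with (2 := L1), H1; [|lra].
    assert (H := Rabs_le_shift _ _ _ _ Ht Hx); lra.
- apply (midpoint_rule (fun t => f x t)); [lra | | |].
  + intros t; apply (Ck_ex_derive_snd 1 f Hf).
  + intros t; apply (Ck_ex_derive_snd 0 _ (Ck_Derive_snd 1 f Hf)).
  + intros t Ht; apply Rle_trans with (2 := L2), H2; [lra|].
    assert (H := Rabs_le_shift _ _ _ _ Ht Hy); lra.
Qed.

Lemma cell_avg_second_order (f : R -> R -> R) (r : R) : Ck 2 f ->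
  exists K, 0 <= K /\ forall dx dy x y,
    0 < dx <= 1 -> 0 < dy <= 1 -> Rabs x <= r -> Rabs y <= r ->
    Rabs (cell_avg dx dy x y f - f x y) <= K * (dx ^ 2 + dy ^ 2).
Proof.
intros Hf; assert (Hf1 := Ck_pred 1 f Hf).
destruct (line_avg_second_order f (r + 1) Hf) as [K [K0 HK]].
exists K; split; trivial; intros dx dy x y Hx Hy Bx By.
rewrite cell_avg_line_avg by (trivial; lra).
destruct (HK (dx / 2) x y) as [E1 _]; [lra..|].
assert (E2 : Rabs (line_avg x (dx / 2) (fun x => line_avg y (dy / 2) (fun y => f x y))
                   - line_avg x (dx / 2) (fun x => f x y)) <= K * (dy / 2) ^ 2).
{ apply line_avg_close; [lra | | |].
  - intros t; apply line_avg_continuous; trivial.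
  - intros t; apply continuity_2d_fst, (Ck_continuity 2 f Hf).
  - intros t Ht; apply HK; [lra | | lra].
    assert (H := Rabs_le_shift _ _ _ _ Ht Bx); lra. }
apply Rabs_le_between in E1; apply Rabs_le_between in E2; apply Rabs_le.
assert (0 <= K * dx ^ 2) by (apply Rmult_le_pos; trivial; apply pow2_ge_0).
assert (0 <= K * dy ^ 2) by (apply Rmult_le_pos; trivial; apply pow2_ge_0).
lra.
Qed.

Lemma cell_avg_ge (f : R -> R -> R) (dx dy xc yc k : R) :
  0 < dx -> 0 < dy -> Ck 1 f ->
  (forall x y, Rabs (x - xc) <= dx / 2 -> Rabs (y - yc) <= dy / 2 -> k <= f x y) ->
  k <= cell_avg dx dy xc yc f.
Proof.
intros Hx Hy Hf Hk; rewrite cell_avg_line_avg by trivial.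
apply line_avg_ge; [lra | intros; apply line_avg_continuous; trivial |].
intros x Bx; apply line_avg_ge; [lra | | intros; apply Hk; trivial].
intros y; apply continuity_2d_snd, (Ck_continuity 1 f Hf).
Qed.

(** * Second-order accuracy of the initial state *)

Lemma sqr_close (A e u u' : R) :
  Rabs u <= A -> Rabs (u' - u) <= e -> e <= A ->
  Rabs (u' * u' - u * u) <= 3 * A * e.
Proof.
intros Hu Hd He.
replace (u' * u' - u * u) with ((u' + u) * (u' - u)) by ring.
rewrite Rabs_mult; apply Rmult_le_compat; try apply Rabs_pos; trivial.
replace (u' + u) with (u' - u + (u + u)) by ring.
eapply Rle_trans; [apply Rabs_triang|].
assert (H := Rabs_triang u u); lra.
Qed.

Lemma quotient_close (A e q q' r r' : R) :
  0 < r -> 0 < r' -> / r <= A -> / r' <= A -> Rabs (r' - r) <= e ->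
  Rabs (q' / r' - q / r) <= A * Rabs (q' - q) + Rabs q * (A * A * e).
Proof.
intros Hr Hr' Ar Ar' Hd.
assert (P := Rinv_0_lt_compat r Hr). assert (P' := Rinv_0_lt_compat r' Hr').
replace (q' / r' - q / r) with (/ r' * (q' - q) + q * (/ r * / r' * - (r' - r)))
  by (field; lra).
eapply Rle_trans; [apply Rabs_triang|].
rewrite !Rabs_mult, Rabs_Ropp, (Rabs_pos_eq (/ r)), (Rabs_pos_eq (/ r')) by lra.
apply Rplus_le_compat.
- apply Rmult_le_compat_r; trivial; apply Rabs_pos.
- apply Rmult_le_compat_l; [apply Rabs_pos|].
  apply Rmult_le_compat; trivial; [|apply Rabs_pos|].
  + apply Rmult_le_pos; lra.
  + apply Rmult_le_compat; lra.
Qed.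

Lemma dot_close (A e : R) (u u' : vec) :
  (forall l, Rabs (comp l u) <= A) -> (forall l, Rabs (comp l u' - comp l u) <= e) ->
  e <= A -> Rabs (dot u' u' - dot u u) <= 9 * A * e.
Proof.
intros Hu Hd He; unfold dot.
assert (H1 := sqr_close A e _ _ (Hu ax1) (Hd ax1) He).
assert (H2 := sqr_close A e _ _ (Hu ax2) (Hd ax2) He).
assert (H3 := sqr_close A e _ _ (Hu ax3) (Hd ax3) He).
apply Rabs_le_between in H1; apply Rabs_le_between in H2; apply Rabs_le_between in H3.
apply Rabs_le; lra.
Qed.

Lemma dot_bound (A : R) (u : vec) :
  (forall l, Rabs (comp l u) <= A) -> Rabs (dot u u) <= 3 * A ^ 2.
Proof.
intros Hu.
assert (B : forall l, comp l u ^ 2 <= A ^ 2).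
{ intros l; rewrite <- pow2_abs; apply pow_incr; split; [apply Rabs_pos | apply Hu]. }
assert (H1 := B ax1); assert (H2 := B ax2); assert (H3 := B ax3).
rewrite Rabs_pos_eq; unfold dot; nra.
Qed.

(** The constant is a Lipschitz constant of the energy on the set where the
    components of the momentum and the field, and the inverse of the density,
    are bounded by A.  The condition e <= A keeps the perturbed state in a
    comparable set. *)
Lemma total_energy_close (A e r r' re re' : R) (m m' B B' : vec) :
  0 < r -> 0 < r' -> / r <= A -> / r' <= A ->
  (forall l, Rabs (comp l m) <= A) -> (forall l, Rabs (comp l B) <= A) ->
  Rabs (r' - r) <= e -> Rabs (re' - re) <= e ->
  (forall l, Rabs (comp l m' - comp l m) <= e) ->
  (forall l, Rabs (comp l B' - comp l B) <= e) -> e <= A ->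
  Rabs (total_energy r' re' m' B' - total_energy r re m B)
  <= (1 + / 2 * (9 * A ^ 2 + 3 * A ^ 4 + 9 * A)) * e.
Proof.
intros Hr Hr' Ar Ar' Am AB Dr Dre Dm DB He.
assert (Q := quotient_close A e (dot m m) (dot m' m') r r' Hr Hr' Ar Ar' Dr).
assert (Sm := dot_close A e m m' Am Dm He).
assert (SB := dot_close A e B B' AB DB He).
assert (Bm := dot_bound A m Am).
assert (P := Rinv_0_lt_compat r Hr).
assert (e0 : 0 <= e) by (eapply Rle_trans; [apply Rabs_pos | exact Dr]).
assert (A0 : 0 <= A) by lra.
assert (Q1 : A * Rabs (dot m' m' - dot m m) <= A * (9 * A * e))
  by (apply Rmult_le_compat_l; trivial).
assert (Q2 : Rabs (dot m m) * (A * A * e) <= 3 * A ^ 2 * (A * A * e))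
  by (apply Rmult_le_compat_r; trivial; repeat apply Rmult_le_pos; trivial).
unfold total_energy.
apply Rabs_le_between in Dre; apply Rabs_le_between in SB.
assert (Q3 := Rle_trans _ _ _ Q (Rplus_le_compat _ _ _ _ Q1 Q2)).
apply Rabs_le_between in Q3; apply Rabs_le; lra.
Qed.

Lemma norm_pair_le {U V : NormedModule R_AbsRing} (x : U) (y : V) :
  norm (x, y) <= norm x + norm y.
Proof.
unfold norm at 1; simpl; unfold prod_norm; simpl.
assert (Hx := norm_ge_0 x); assert (Hy := norm_ge_0 y).
apply Rsqr_incr_0_var; [|lra].
unfold Rsqr; rewrite sqrt_sqrt; nra.
Qed.

Lemma norm_state_le (A : state) (e : R) :
  Rabs (rho A) <= e -> (forall l, Rabs (comp l (mom A)) <= e) ->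
  (forall l, Rabs (comp l (mag A)) <= e) -> Rabs (ener A) <= e ->
  norm A <= 8 * e.
Proof.
intros Hr Hm HB HE.
assert (H1 := Hm ax1); assert (H2 := Hm ax2); assert (H3 := Hm ax3).
assert (H4 := HB ax1); assert (H5 := HB ax2); assert (H6 := HB ax3).
destruct A as [[[r [[m1 m2] m3]] [[b1 b2] b3]] E].
unfold rho, mom, mag, ener in *; simpl in *.
pose (W := prod_NormedModule _ R_NormedModule R_NormedModule).
pose (X := prod_NormedModule _ W R_NormedModule).
assert (N : forall u v w : R, @norm _ X ((u, v), w) <= Rabs u + Rabs v + Rabs w).
{ intros u v w; eapply Rle_trans; [apply (norm_pair_le (U := W) (V := R_NormedModule))|].
  apply Rplus_le_compat_r, (norm_pair_le (U := R_NormedModule) (V := R_NormedModule)). }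
assert (Nm := N m1 m2 m3); assert (NB := N b1 b2 b3).
pose (Y := prod_NormedModule _ R_NormedModule X).
pose (Z := prod_NormedModule _ Y X).
assert (N1 := norm_pair_le (U := Z) (V := R_NormedModule) (r, (m1, m2, m3), (b1, b2, b3)) E).
assert (N2 := norm_pair_le (U := Y) (V := X) (r, (m1, m2, m3)) (b1, b2, b3)).
assert (N3 := norm_pair_le (U := R_NormedModule) (V := X) r (m1, m2, m3)).
change (@norm _ R_NormedModule r) with (Rabs r) in N3.
change (@norm _ R_NormedModule E) with (Rabs E) in N1.
refine (Rle_trans _ _ _ N1 _).
refine (Rle_trans _ _ _ (Rplus_le_compat_r _ _ _ (Rle_trans _ _ _ N2
  (Rplus_le_compat _ _ _ _ (Rle_trans _ _ _ N3 (Rplus_le_compat_l _ _ _ Nm)) NB))) _).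
lra.
Qed.

Lemma axis_uniform_bound (P : axis -> R -> Prop) :
  (forall l K K', K <= K' -> P l K -> P l K') -> (forall l, exists K, P l K) ->
  exists K, forall l, P l K.
Proof.
intros Hmono H.
destruct (H ax1) as [K1 H1]; destruct (H ax2) as [K2 H2]; destruct (H ax3) as [K3 H3].
exists (Rmax K1 (Rmax K2 K3)); intros l; destruct l.
- apply Hmono with (2 := H1); apply Rmax_l.
- apply Hmono with (2 := H2); eapply Rle_trans; [|apply Rmax_r]; apply Rmax_l.
- apply Hmono with (2 := H3); eapply Rle_trans; [|apply Rmax_r]; apply Rmax_r.
Qed.

(** The avg argument gives the average for the mesh sizes dx, dy around the
    point (x, y); accuracy is uniform over a square of half-width r. *)
Definition second_order (r : R) (avg : R -> R -> R -> R -> R) (f : R -> R -> R) (K : R) :=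
  forall dx dy x y, 0 < dx <= 1 -> 0 < dy <= 1 -> Rabs x <= r -> Rabs y <= r ->
    Rabs (avg dx dy x y - f x y) <= K * (dx ^ 2 + dy ^ 2).

Lemma second_order_mono (r : R) avg f K K' :
  K <= K' -> second_order r avg f K -> second_order r avg f K'.
Proof.
intros HK H dx dy x y Hx Hy Bx By.
eapply Rle_trans; [apply H; trivial|].
apply Rmult_le_compat_r; trivial.
apply Rplus_le_le_0_compat; apply pow2_ge_0.
Qed.

(** Indexing the differently averaged components of the discrete field by their
    axis lets one constant serve for all three. *)
Definition init_mag (D : fields) (l : axis) (dx dy x y : R) : R :=
  match l with
  | ax1 => line_avg y dy (fun t => comp ax1 (f_mag D x t))
  | ax2 => line_avg x dx (fun t => comp ax2 (f_mag D t y))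
  | ax3 => cell_avg dx dy x y (fun x y => comp ax3 (f_mag D x y))
  end.

Lemma init_mag_second_order (D : fields) (r : R) (l : axis) :
  Ck 2 (fun x y => comp l (f_mag D x y)) ->
  exists K, second_order r (init_mag D l) (fun x y => comp l (f_mag D x y)) K.
Proof.
intros Hf; destruct l; unfold second_order, init_mag.
- destruct (line_avg_second_order _ r Hf) as [K [K0 HK]]; exists K.
  intros dx dy x y Hx Hy Bx By; destruct (HK dy x y Hy Bx By) as [_ E].
  eapply Rle_trans; [exact E|].
  apply Rmult_le_compat_l; trivial. assert (H := pow2_ge_0 dx); lra.
- destruct (line_avg_second_order _ r Hf) as [K [K0 HK]]; exists K.
  intros dx dy x y Hx Hy Bx By; destruct (HK dx x y Hx Bx By) as [E _].
  eapply Rle_trans; [exact E|].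
  apply Rmult_le_compat_l; trivial. assert (H := pow2_ge_0 dy); lra.
- destruct (cell_avg_second_order _ r Hf) as [K [_ HK]]; exists K; exact HK.
Qed.

Lemma init_state_second_order (D : fields) (M : R) :
  initial_fields 2 D ->
  exists K : R, forall (dx dy ox oy : R) (i j : Z),
    0 < dx <= 1 -> 0 < dy <= 1 ->
    Rabs (node ox dx i) <= M -> Rabs (node oy dy j) <= M ->
    norm (minus (init_state dx dy ox oy D i j)
                (exact_state D (node ox dx i) (node oy dy j)))
    <= K * (dx ^ 2 + dy ^ 2).
Proof.
intros ((Cr & Cm & CB & Ce) & Pr & _ & _).
destruct (cell_avg_second_order _ M Cr) as [Kr [_ Hr]].
destruct (cell_avg_second_order _ M Ce) as [Ke [_ He]].
destruct (axis_uniform_bound (fun l => second_order M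
    (fun dx dy x y => cell_avg dx dy x y (fun x y => comp l (f_mom D x y)))
    (fun x y => comp l (f_mom D x y)))) as [Km Hm].
{ intros l K K'; apply second_order_mono. }
{ intros l; destruct (cell_avg_second_order _ M (Cm l)) as [K [_ HK]]; exists K; exact HK. }
destruct (axis_uniform_bound (fun l => second_order M
    (init_mag D l) (fun x y => comp l (f_mag D x y)))) as [KB HB].
{ intros l K K'; apply second_order_mono. }
{ intros l; apply init_mag_second_order; trivial. }
destruct (continuous_2d_bounded (fun x y => / f_rho D x y) (M + 1)) as [Ar HAr].
{ intros x y; apply continuity_2d_pt_inv; [apply (Ck_continuity 2 _ Cr)|].
  apply Rgt_not_eq, Pr. }
destruct (axis_uniform_bound (fun l K => forall x y, Rabs x <= M -> Rabs y <= M ->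
    Rabs (comp l (f_mom D x y)) <= K)) as [Am HAm].
{ intros l K K' HK H x y Bx By; eapply Rle_trans; [apply H|]; trivial. }
{ intros l; apply (continuous_2d_bounded (fun x y => comp l (f_mom D x y))),
    (Ck_continuity 2), Cm. }
destruct (axis_uniform_bound (fun l K => forall x y, Rabs x <= M -> Rabs y <= M ->
    Rabs (comp l (f_mag D x y)) <= K)) as [AB HAB].
{ intros l K K' HK H x y Bx By; eapply Rle_trans; [apply H|]; trivial. }
{ intros l; apply (continuous_2d_bounded (fun x y => comp l (f_mag D x y))),
    (Ck_continuity 2), CB. }
(* K bounds all error constants, and A all sizes on the enlarged square; the
   summand 2 * K absorbs the errors themselves, as dx^2 + dy^2 <= 2. *)
set (K := Rabs Kr + Rabs Ke + Rabs Km + Rabs KB).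
set (A := Rabs Ar + Rabs Am + Rabs AB + 2 * K).
assert (P1 := Rle_abs Kr). assert (P1' := Rabs_pos Kr).
assert (P2 := Rle_abs Ke). assert (P2' := Rabs_pos Ke).
assert (P3 := Rle_abs Km). assert (P3' := Rabs_pos Km).
assert (P4 := Rle_abs KB). assert (P4' := Rabs_pos KB).
assert (P5 := Rle_abs Ar). assert (P5' := Rabs_pos Ar).
assert (P6 := Rle_abs Am). assert (P6' := Rabs_pos Am).
assert (P7 := Rle_abs AB). assert (P7' := Rabs_pos AB).
assert (K0 : 0 <= K) by (unfold K; lra).
assert (A0 : 0 <= A) by (unfold A; lra).
set (L := 1 + / 2 * (9 * A ^ 2 + 3 * A ^ 4 + 9 * A)).
assert (L1 : 1 <= L).
{ unfold L. assert (0 <= A ^ 2) by apply pow2_ge_0.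
  assert (0 <= A ^ 4) by (apply pow_le; trivial). lra. }
exists (8 * (L * K)); intros dx dy ox oy i j Hx Hy Bx By.
set (x := node ox dx i) in *; set (y := node oy dy j) in *.
set (s := dx ^ 2 + dy ^ 2).
assert (s0 : 0 <= s) by (apply Rplus_le_le_0_compat; apply pow2_ge_0).
assert (s2 : s <= 2) by (unfold s; nra).
assert (Ks0 : 0 <= K * s) by (apply Rmult_le_pos; trivial).
assert (W : forall u k, k <= K -> u <= k * s -> u <= K * s).
{ intros u k Hk Hu; apply Rle_trans with (1 := Hu), Rmult_le_compat_r; trivial. }
specialize (Hr dx dy x y Hx Hy Bx By); apply W in Hr; [|unfold K; lra].
specialize (He dx dy x y Hx Hy Bx By); apply W in He; [|unfold K; lra].
assert (Em : forall l, Rabs (cell_avg dx dy x y (fun x y => comp l (f_mom D x y))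
                             - comp l (f_mom D x y)) <= K * s).
{ intros l; apply W with Km; [unfold K; lra|]; apply Hm; trivial. }
assert (EB : forall l, Rabs (init_mag D l dx dy x y - comp l (f_mag D x y)) <= K * s).
{ intros l; apply W with KB; [unfold K; lra|]; apply HB; trivial. }
clear Hm HB.
set (m := vec_of (fun l => cell_avg dx dy x y (fun x y => comp l (f_mom D x y)))).
set (B := vec_of (fun l => init_mag D l dx dy x y)).
assert (Cmm : forall l, comp l m = cell_avg dx dy x y (fun x y => comp l (f_mom D x y)))
  by (intros l; destruct l; reflexivity).
assert (CBB : forall l, comp l B = init_mag D l dx dy x y)
  by (intros l; destruct l; reflexivity).
replace (init_state dx dy ox oy D i j)
  with (cell_avg dx dy x y (f_rho D), m, B,
        total_energy (cell_avg dx dy x y (f_rho D)) (cell_avg dx dy x y (f_rhoe D)) m B).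
2:{ unfold B, m, vec_of, init_mag, line_avg, init_state; cbv zeta.
    rewrite !node_succ, !node_pred; reflexivity. }
assert (Ir : forall u v, Rabs u <= M + 1 -> Rabs v <= M + 1 ->
  / f_rho D u v <= A /\ / A <= f_rho D u v).
{ intros u v Bu Bv.
  assert (P := Rinv_0_lt_compat _ (Pr u v)).
  assert (Q : / f_rho D u v <= A).
  { apply Rle_trans with Ar; [|unfold A; lra].
    eapply Rle_trans; [apply Rle_abs | apply HAr; trivial]. }
  split; trivial.
  rewrite <- (Rinv_inv (f_rho D u v)); apply Rinv_le_contravar; trivial. }
destruct (Ir x y) as [I1 _]; [lra..|].
assert (A1 : 0 < A) by (apply Rlt_le_trans with (2 := I1), Rinv_0_lt_compat, Pr).
(* The cell sticks out of the square of half-width M by at most 1/2. *)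
assert (Tr : / A <= cell_avg dx dy x y (f_rho D)).
{ apply cell_avg_ge; [lra | lra | apply Ck_pred; trivial |].
  intros u v Bu Bv; apply Ir.
  - assert (H := Rabs_le_shift _ _ _ _ Bu Bx); lra.
  - assert (H := Rabs_le_shift _ _ _ _ Bv By); lra. }
replace (8 * (L * K) * s) with (8 * (L * (K * s))) by ring.
assert (KL : K * s <= L * (K * s)) by nra.
apply norm_state_le.
- apply Rle_trans with (2 := KL); exact Hr.
- intros l; apply Rle_trans with (2 := KL).
  change (mom (minus ?a ?b)) with (minus (mom a) (mom b)).
  rewrite comp_minus; specialize (Em l); rewrite <- Cmm in Em; exact Em.
- intros l; apply Rle_trans with (2 := KL).
  change (mag (minus ?a ?b)) with (minus (mag a) (mag b)).
  rewrite comp_minus; specialize (EB l); rewrite <- CBB in EB; exact EB.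
- unfold exact_state.
  change (ener (minus (?a, ?b, ?c, ?d) (?a', ?b', ?c', ?d'))) with (d - d').
  assert (P := Rinv_0_lt_compat A A1).
  apply total_energy_close; [apply Pr | | exact I1 | | | | exact Hr | exact He | | |].
  + apply Rlt_le_trans with (2 := Tr); trivial.
  + rewrite <- (Rinv_inv A); apply Rinv_le_contravar; trivial.
  + intros l; apply Rle_trans with Am; [apply HAm; trivial | unfold A; lra].
  + intros l; apply Rle_trans with AB; [apply HAB; trivial | unfold A; lra].
  + intros l; rewrite Cmm; apply Em.
  + intros l; rewrite CBB; apply EB.
  + apply Rle_trans with (K * 2); [apply Rmult_le_compat_l; trivial | unfold A; lra].
Qed.

Theorem theorem4p6 :
  (forall (D : fields) (dx dy ox oy : R),
     initial_fields 1 D -> 0 < dx -> 0 < dy ->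
     (forall i j : Z, admissible (init_state dx dy ox oy D i j)) /\
     DDF dx dy (init_state dx dy ox oy D))
  /\
  (forall (D : fields) (M : R),
     initial_fields 2 D ->
     exists K : R, forall (dx dy ox oy : R) (i j : Z),
       0 < dx <= 1 -> 0 < dy <= 1 ->
       Rabs (node ox dx i) <= M -> Rabs (node oy dy j) <= M ->
       norm (minus (init_state dx dy ox oy D i j)
                   (exact_state D (node ox dx i) (node oy dy j)))
       <= K * (dx ^ 2 + dy ^ 2))
  /\
  (forall (p : R -> R -> R) (dx dy : R) (dt a1 a2 : nat -> R)
          (U : nat -> Z -> Z -> state),
     eos p -> 0 < dx -> 0 < dy ->
     (forall (n : nat) (i j : Z),
        U (S n) i j = LF_step p dx dy (dt n) (a1 n) (a2 n) (U n) i j) ->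
     (forall i j : Z, admissible (U O i j)) ->
     DDF dx dy (U O) ->
     (forall n : nat, Rbar_lt (sup_alpha1 p (U n)) (a1 n)) ->
     (forall n : nat, Rbar_lt (sup_alpha2 p (U n)) (a2 n)) ->
     (forall n : nat, 0 < a1 n * dt n / dx + a2 n * dt n / dy <= 1) ->
     forall n : nat,
       (forall i j : Z, admissible (U (S n) i j)) /\ DDF dx dy (U (S n))).
Proof.
split; [|split].
- intros D dx dy ox oy HD Hx Hy; split.
  + intros i j; apply init_state_admissible; trivial.
  + apply init_state_DDF; trivial.
- exact init_state_second_order.
- intros p dx dy dt a1 a2 U Hp Hx Hy Hstep HG HD H1 H2 Hcfl n.
  apply (LF_scheme_preserves p dx dy dt a1 a2 U); trivial.
Qed.
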